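(* Let $N,\mu,m$ be positive integers with $\frac N2\leq\mu<N$ and $\gcd(m,\mu+1)<\frac{\mu+1}{N-\mu}$, and let $\lambda=(m^{N-\mu})$. Then the singular polynomial $\zeta_\lambda^x$ on $\mathbb{R}^N$ for $\kappa=-\frac{m}{\mu+1}$ is of isotype $(\mu,N-\mu)$.
   Context: $\kappa$ is a formal parameter (transcendental over $\mathbb{Q}$); polynomials in $x=(x_1,\ldots,x_N)$ have coefficients in $\mathbb{Q}(\kappa)$. For $w\in S_N$, $(xw)_i=x_{w(i)}$ and $wf(x)=f(xw)$; $(i,j)$ denotes a transposition. Dunkl operators: $\mathcal{D}_i f(x)=\frac{\partial}{\partial x_i}f(x)+\kappa\sum_{j\neq i}\frac{f(x)-(i,j)f(x)}{x_i-x_j}$. Set $\mathcal{U}_i f=\mathcal{D}_i(x_i f)-\kappa\sum_{j=1}^{i-1}(j,i)f$, $1\leq i\leq N$. A nonzero polynomial $p$ is a singular polynomial for the singular value $\kappa_0$ if $\mathcal{D}_ip=0$ for all $1\leq i\leq N$ when $\kappa$ is specialized to $\kappa_0$. It is known that, under the stated hypotheses, the coefficients of $\zeta_\lambda^x$ have no pole at $\kappa=-\frac{m}{\mu+1}$ and its specialization there is a singular polynomial. For $\alpha\in\mathbb{N}_0^N$: $|\alpha|=\sum\alpha_i$, $\alpha^+$ is the nonincreasing rearrangement of $\alpha$. $\alpha\succ\beta$ means $\alpha\neq\beta$ and $\sum_{i=1}^j\alpha_i\geq\sum_{i=1}^j\beta_i$ for $1\leq j\leq N$; $\alpha\vartriangleright\beta$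 means $|\alpha|=|\beta|$ and either $\alpha^+\succ\beta^+$, or $\alpha^+=\beta^+$ and $\alpha\succ\beta$. $r(\alpha,i)=\#\{j:\alpha_j>\alpha_i\}+\#\{j:1\leq j\leq i,\alpha_j=\alpha_i\}$ and $\xi_i(\alpha)=(N-r(\alpha,i))\kappa+\alpha_i+1$. The $x$-monic nonsymmetric Jack polynomial $\zeta_\alpha^x$ is the unique polynomial $\zeta_\alpha^x=x^\alpha+\sum_{\alpha\vartriangleright\beta}A^x_{\beta\alpha}x^\beta$, $A^x_{\beta\alpha}\in\mathbb{Q}(\kappa)$, with $\mathcal{U}_i\zeta^x_\alpha=\xi_i(\alpha)\zeta^x_\alpha$ for $1\leq i\leq N$. $(m^{N-\mu})$ denotes $m$ repeated $N-\mu$ times, followed by $\mu$ zeros. The irreducible representations of $S_N$ are labeled by partitions of $N$ in the usual way ($(N)$ labels the trivial representation). A polynomial $f$ (here with rational coefficients, after specializing $\kappa$) is of isotype $\tau$ if $f$ is an element of an irreducible $S_N$-submodule of the space of homogeneous polynomials on which the representation $\tau$ is realized. *)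

(* Defs.v *)
From HB Require Import structures.
From mathcomp Require Import all_boot all_order all_fingroup all_algebra.
From mathcomp Require Import mpoly.

Set Implicit Arguments.
Unset Strict Implicit.
Unset Printing Implicit Defensive.

Import GRing.Theory.
Local Open Scope ring_scope.

(* Variables x_1, ..., x_N are 'X_i with i : 'I_N, so indices are shifted by
   one.  The action (wf)(x) = f(xw), (xw)_i = x_(w i), is [msym w f], which
   substitutes 'X_(w i) for 'X_i. *)

Lemma divdiff_subproof (R : idomainType) (N : nat) (i j : 'I_N)
    (f : {mpoly R[N]}) :
  exists g : {mpoly R[N]}, ('X_i - 'X_j) * g == f - msym (tperm i j) f.
Proof.
pose P (h : {mpoly R[N]}) := exists g, ('X_i - 'X_j) * g == h - msym (tperm i j) h.
have P1 : P 1 by exists 0; rewrite mulr0 msym1 subrr.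
have PM a b : P a -> P b -> P (a * b).
  move=> [g /eqP ga] [h /eqP hb]; exists (g * b + msym (tperm i j) a * h).
  rewrite mulrDr mulrA ga mulrCA hb msymM mulrBl mulrBr addrA.
  by rewrite subrK.
have PX k : P 'X_k.
  rewrite /P /msym mmapX mmap1U; case: tpermP => [->|->|_ _].
  - by exists 1; rewrite mulr1.
  - by exists (- 1); rewrite mulrN1 opprB.
  - by exists 0; rewrite mulr0 subrr.
have PXm m : P 'X_[m].
  rewrite mpolyXE_id; apply: (big_ind P) => // k _.
  by elim: (m k) => [|d IHd]; rewrite ?expr0 // exprS; apply: PM.
rewrite -/(P f); elim/mpolyind: f => [|c m p _ _ [h /eqP hp]].
  by exists 0; rewrite mulr0 msym0 subr0.
have [g /eqP gm] := PXm m; exists (c *: g + h).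
by rewrite mulrDr -scalerAr gm hp msymD msymZ scalerBr opprD addrACA.
Qed.

(* (f(x) - f(x(i,j))) / (x_i - x_j); for i != j the quotient is unique. *)
Definition divdiff (R : idomainType) (N : nat) (i j : 'I_N)
    (f : {mpoly R[N]}) : {mpoly R[N]} :=
  xchoose (divdiff_subproof i j f).

Definition dunkl (R : idomainType) (N : nat) (kappa : R) (i : 'I_N)
    (f : {mpoly R[N]}) : {mpoly R[N]} :=
  mderiv i f + kappa *: \sum_(j < N | j != i) divdiff i j f.

Definition dunklU (R : idomainType) (N : nat) (kappa : R) (i : 'I_N)
    (f : {mpoly R[N]}) : {mpoly R[N]} :=
  dunkl kappa i ('X_i * f)
  - kappa *: \sum_(j < N | (j < i)%N) msym (tperm j i) f.

Definition singular (R : idomainType) (N : nat) (kappa : R)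
    (f : {mpoly R[N]}) : Prop :=
  f != 0 /\ forall i : 'I_N, dunkl kappa i f = 0.

Definition comp_plus (N : nat) (a : 'X_{1..N}) : 'X_{1..N} :=
  [multinom of sort geq a].

Definition comp_succ (N : nat) (a b : 'X_{1..N}) : bool :=
  (a != b) &&
  [forall j : 'I_N,
     (\sum_(i < N | (i <= j)%N) b i <= \sum_(i < N | (i <= j)%N) a i)%N].

Definition comp_rhd (N : nat) (a b : 'X_{1..N}) : bool :=
  (mdeg a == mdeg b) &&
  (comp_succ (comp_plus a) (comp_plus b)
   || (comp_plus a == comp_plus b) && comp_succ a b).

Definition comp_rank (N : nat) (a : 'X_{1..N}) (i : 'I_N) : nat :=
  (#|[set j : 'I_N | a i < a j]|
   + #|[set j : 'I_N | (j <= i) && (a j == a i)]|)%N.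

Definition xi (R : idomainType) (N : nat) (kappa : R) (a : 'X_{1..N})
    (i : 'I_N) : R :=
  (N%:R - (comp_rank a i)%:R) * kappa + (a i)%:R + 1.

Definition Qkappa : fieldType := {fraction {poly rat}}.
Definition kappa : Qkappa := tofrac 'X.

Definition is_jack (N : nat) (a : 'X_{1..N}) (z : {mpoly Qkappa[N]}) : Prop :=
  [/\ z@_a = 1,
      forall b, b \in msupp z -> b != a -> comp_rhd a b
    & forall i : 'I_N, dunklU kappa i z = xi kappa a i *: z].

(* c has no pole at k0 and takes the value v there. *)
Definition has_value_at (k0 : rat) (c : Qkappa) (v : rat) : Prop :=
  exists p q : {poly rat},
    [/\ q.[k0] != 0, c = tofrac p / tofrac q & v = p.[k0] / q.[k0]].

Definition specializes (N : nat) (k0 : rat) (z : {mpoly Qkappa[N]})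
    (f : {mpoly rat[N]}) : Prop :=
  forall b : 'X_{1..N}, has_value_at k0 z@_b f@_b.

Definition submodule (N : nat) (V : {mpoly rat[N]} -> Prop) : Prop :=
  [/\ V 0,
      forall (c : rat) p q, V p -> V q -> V (c *: p + q)
    & forall (w : 'S_N) p, V p -> V (msym w p)].

Definition irreducible_submodule (N : nat) (V : {mpoly rat[N]} -> Prop) :
    Prop :=
  [/\ submodule V,
      exists2 p, V p & p != 0
    & forall W : {mpoly rat[N]} -> Prop,
        submodule W -> (forall p, W p -> V p) ->
        (forall p, W p -> p = 0) \/ (forall p, V p -> W p)].

(* A tableau T : 'I_N -> rows * columns places the entry i in the box T i of
   the diagram of tau; when sumn tau = N an injective T fills every box. *)
Definition is_tableau (N : nat) (tau : seq nat)
    (T : {ffun 'I_N -> 'I_N * 'I_N}) : bool :=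
  injectiveb T && [forall i, (T i).2 < nth 0%N tau (T i).1]%N.

(* Specht polynomial of T: product of the Vandermonde polynomials of the sets
   of variables indexed by the columns of T. *)
Definition specht_poly (N : nat) (T : {ffun 'I_N -> 'I_N * 'I_N}) :
    {mpoly rat[N]} :=
  \prod_(i < N) \prod_(j < N | ((T i).2 == (T j).2) && ((T i).1 < (T j).1)%N)
    ('X_i - 'X_j).

(* The Specht module S^tau, the irreducible representation labeled by tau:
   the span of the Specht polynomials of all tableaux of shape tau.  Sending a
   tabloid to the monomial \prod_i 'X_i ^+ (row of i) identifies it with the
   span of the polytabloids.  S^(N) is trivial, S^(1,...,1) is the sign. *)
Definition specht_module (N : nat) (tau : seq nat) (p : {mpoly rat[N]}) :
    Prop :=
  exists c : {ffun 'I_N -> 'I_N * 'I_N} -> rat,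
    p = \sum_(T | is_tableau tau T) c T *: specht_poly T.

Definition submodule_iso (N : nat) (V W : {mpoly rat[N]} -> Prop) : Prop :=
  exists phi : {mpoly rat[N]} -> {mpoly rat[N]},
    [/\ forall (c : rat) p q, V p -> V q ->
          phi (c *: p + q) = c *: phi p + phi q,
        forall (w : 'S_N) p, V p -> phi (msym w p) = msym w (phi p),
        forall p q, V p -> V q -> phi p = phi q -> p = q
      & forall q, W q <-> exists2 p, V p & q = phi p].

Definition isotype (N : nat) (tau : seq nat) (f : {mpoly rat[N]}) : Prop :=
  exists (d : nat) (V : {mpoly rat[N]} -> Prop),
    [/\ forall p, V p -> p \is d.-homog,
        irreducible_submodule V,
        submodule_iso (specht_module (N := N) tau) V
      & V f].

(* Main.v *)
(** Write n = N - mu, A for the first n indices, c for the last index of A,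
    k0 = - m / (mu + 1), and f for the specialization of zeta.  On a top
    monomial x^b the operators U_i are triangular with diagonal xi_i(b).  The
    gcd condition makes lambda the only b with xi_i(b) = xi_i(lambda) at k0 for
    all i, so zeta has no pole there: a multiple of zeta clearing a pole would
    specialize to an eigenvector without x^lambda.  The same triangularity shows
    that f is fixed by S_n x S_mu.  Since
      U_i = x_i D_i + 1 + kappa \sum_(j > i) (i, j),
    D_j f = 0 for j outside A, and x_c D_c f is - k0 times
    h = f + \sum_(j not in A) (c, j) f.  This h is symmetric in the variables c
    and N and an eigenvector of U_c and U_N, with eigenvalues which force the
    exponents of its top monomial to be 0 at c and positive at N; exchanging
    these two variables gives a higher monomial, so h = 0 and f is singular.

    The equation h = 0 together with the S_n x S_mu invariance determines the
    function w |-> e (w f) up to a scalar, where e is the sum over S_n x S_mu: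
    exchanging an index that w moves out of A expresses it through permutations
    that move fewer indices out of A.  Hence e maps the span of the orbit of f
    to the line of f, which makes this span irreducible (use an invariant inner
    product).  The Specht module of shape (mu, n) satisfies the same relation,
    because mu + 1 indices cannot lie in mu different columns; hence
    p |-> \sum_w (coefficient of \prod_(i in A) x_i in w^-1 p) w f is injective
    on it. *)

Require Import Defs.
From HB Require Import structures.
From Stdlib Require Import Classical.
From mathcomp Require Import all_boot all_order all_fingroup all_algebra.
From mathcomp Require Import mpoly zify ring.

Set Implicit Arguments.
Unset Strict Implicit.
Unset Printing Implicit Defensive.

Import GRing.Theory.
Local Open Scope ring_scope.

(** * Dunkl operators *)

Section DunklOperators.

Context (R : idomainType) (N : nat).
Implicit Types (i j : 'I_N) (p q : {mpoly R[N]}) (w : 'S_N) (b : 'X_{1..N}).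

Lemma msymXi w i : msym w 'X_i = 'X_(w i) :> {mpoly R[N]}.
Proof. by rewrite /msym mmapX mmap1U. Qed.

Lemma msym_mderiv w i p : msym w (mderiv i p) = mderiv (w i) (msym w p).
Proof.
apply/mpolyP=> b; rewrite mcoeff_sym !mcoeff_deriv mcoeff_sym !mnmE.
congr (_@__ *+ _); apply/mnmP=> k; rewrite !mnmE; congr (_ + _)%N.
by rewrite (inj_eq perm_inj).
Qed.

Lemma subXX_neq0 i j : i != j -> 'X_i - 'X_j != 0 :> {mpoly R[N]}.
Proof.
move=> ij; apply/eqP=> /(congr1 (mcoeff U_(i))) /eqP.
by rewrite mcoeffB !mcoeffXU mcoeff0 eqxx [j == i]eq_sym
  (negPf ij) subr0 oner_eq0.
Qed.

Lemma divdiffE i j p : ('X_i - 'X_j) * divdiff i j p = p - msym (tperm i j) p.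
Proof. by apply/eqP; rewrite (xchooseP (divdiff_subproof i j p)). Qed.

Lemma divdiff_unique i j p q : i != j ->
  ('X_i - 'X_j) * q = p - msym (tperm i j) p -> divdiff i j p = q.
Proof.
by move=> ij def_q; apply: (mulfI (subXX_neq0 ij)); rewrite divdiffE.
Qed.

Lemma divdiffD i j : i != j -> {morph divdiff (R := R) i j : p q / p + q}.
Proof.
move=> ij p q; apply: divdiff_unique => //.
rewrite mulrDr; apply: etrans (congr2 +%R (divdiffE i j p) (divdiffE i j q)) _.
by rewrite msymD opprD addrACA.
Qed.

Lemma divdiffZ i j c p : i != j -> divdiff i j (c *: p) = c *: divdiff i j p.
Proof.
by move=> ij; apply: divdiff_unique; rewrite // -scalerAr divdiffE msymZ scalerBr.
Qed.

Lemma msym_divdiff w i j p : i != j ->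
  msym w (divdiff i j p) = divdiff (w i) (w j) (msym w p).
Proof.
move=> ij; apply/esym/divdiff_unique; first by rewrite (inj_eq perm_inj).
have := congr1 (msym w) (divdiffE i j p).
rewrite msymM (msymB w 'X_i) (msymB w p) !msymXi -(msymMm p) => ->.
by rewrite -(msymMm p) -tpermJ -conjgC.
Qed.

Lemma divdiffXM i j p : i != j ->
  divdiff i j ('X_i * p) = 'X_i * divdiff i j p + msym (tperm i j) p.
Proof.
move=> ij; apply: divdiff_unique => //.
rewrite mulrDr mulrCA divdiffE msymM msymXi tpermL mulrBr mulrBl.
by rewrite addrA subrK.
Qed.

Context (kap : R).

Lemma dunklD i : {morph dunkl kap i : p q / p + q}.
Proof.
move=> p q; rewrite /dunkl mderivD addrACA -scalerDr -big_split /=.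
by congr (_ + _ *: _); apply: eq_bigr => j ji; rewrite divdiffD // eq_sym.
Qed.

Lemma dunklZ i c p : dunkl kap i (c *: p) = c *: dunkl kap i p.
Proof.
rewrite /dunkl mderivZ scalerDr !scalerA [c * kap]mulrC -scalerA.
congr (_ + _ *: _); rewrite scaler_sumr.
by apply: eq_bigr => j ji; rewrite divdiffZ // eq_sym.
Qed.

Lemma dunkl0 i : dunkl kap i 0 = 0.
Proof. by have := dunklZ i 0 0; rewrite !scale0r. Qed.

Lemma dunkl_sum i I (r : seq I) (P : pred I) (F : I -> {mpoly R[N]}) :
  dunkl kap i (\sum_(k <- r | P k) F k) = \sum_(k <- r | P k) dunkl kap i (F k).
Proof. exact: (big_morph _ (dunklD i) (dunkl0 i)). Qed.

Lemma msym_dunkl w i p : msym w (dunkl kap i p) = dunkl kap (w i) (msym w p).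
Proof.
rewrite /dunkl msymD msymZ msym_mderiv; congr (_ + _ *: _).
rewrite [RHS](reindex_inj (@perm_inj _ w)) /=.
rewrite raddf_sum; apply: eq_big => [j|j ji]; first by rewrite (inj_eq perm_inj).
by rewrite /= msym_divdiff // eq_sym.
Qed.

(** Pulling ['X_i] out of the Dunkl operator leaves one transposition (i, j) for every j other than
    i; those with j < i cancel against the correction term in U_i. *)
Lemma dunklUE i p :
  dunklU kap i p =
  'X_i * dunkl kap i p + p + kap *: \sum_(j < N | (i < j)%N) msym (tperm i j) p.
Proof.
rewrite /dunklU /dunkl mderivM mderivX mnm1E eqxx scale1r.
have -> : (U_(i) - U_(i) = 0)%MM by apply/mnmP=> k; rewrite mnmBE subnn mnm0E.
rewrite mpolyX0 mul1r.
set lo := (X in _ - kap *: X); set hi := (X in _ = _ + kap *: X).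
have sumE : \sum_(j < N | j != i) divdiff i j ('X_i * p) =
    'X_i * (\sum_(j < N | j != i) divdiff i j p) + (lo + hi).
  rewrite mulr_sumr.
  transitivity (\sum_(j < N | j != i) ('X_i * divdiff i j p +
    msym (tperm i j) p)).
    by apply: eq_bigr => j ji; rewrite divdiffXM 1?eq_sym.
  rewrite big_split /=; congr (_ + _).
  rewrite (bigID (fun j : 'I_N => (j < i)%N)) /=; congr (_ + _).
    by apply: eq_big => [j|j _]; [rewrite -val_eqE /=; lia|rewrite tpermC].
  by apply: eq_bigl => j; rewrite -val_eqE /=; lia.
apply: etrans (congr1 (fun s => _ + kap *: s - kap *: lo) sumE) _.
rewrite mulrDr -scalerAr !scalerDr.
rewrite -!addrA addrCA; congr (_ + _); rewrite addrCA; congr (_ + _).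
by congr (_ + _); rewrite addrC subrK.
Qed.

Lemma dunklUD i : {morph dunklU kap i : p q / p + q}.
Proof.
move=> p q; rewrite !dunklUE dunklD mulrDr.
rewrite (eq_bigr _ (fun j _ => msymD (tperm i j) p q)) big_split /= scalerDr.
by rewrite [RHS]addrACA; congr (_ + _); exact: addrACA.
Qed.

Lemma dunklUZ i c p : dunklU kap i (c *: p) = c *: dunklU kap i p.
Proof.
rewrite !dunklUE dunklZ -scalerAr !scalerDr !scalerA [c * _]mulrC -scalerA.
congr (_ + _ *: _); rewrite scaler_sumr.
by apply: eq_bigr => j _; rewrite msymZ.
Qed.

(** The degenerate Hecke relation for two neighbouring indices: conjugation matches the sums over
    later indices except for the term (i, j) itself, which gives [kap *: p]. *)
Lemma dunklU_swap i j p : j = i.+1 :> nat ->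
  dunklU kap i (msym (tperm i j) p) = msym (tperm i j) (dunklU kap j p) +
    kap *: p.
Proof.
move=> ji; have neq_ij : i != j by rewrite -val_eqE /= ji neq_ltn leqnn.
rewrite !dunklUE !msymD msymM msymXi msym_dunkl tpermR -!addrA.
congr (_ + (_ + _)); rewrite msymZ -scalerDr; congr (_ *: _).
rewrite (bigD1 j) /=; last by rewrite ji.
rewrite -msymMm tperm2 msym1m addrC; congr (_ + _); rewrite raddf_sum.
apply: eq_big => [k|k /andP[ik kj]].
  by rewrite -val_eqE /= ji; lia.
rewrite /= -!msymMm; congr (msym _ _).
rewrite [RHS]conjgC tpermJ tpermR tpermD //;
  first by rewrite -val_eqE /= neq_ltn ik.
by rewrite eq_sym.
Qed.

Lemma dunklU_swapS i j p : j = i.+1 :> nat ->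
  dunklU kap j (msym (tperm i j) p) = msym (tperm i j)
    (dunklU kap i p) - kap *: p.
Proof.
move=> ji; set t := tperm i j.
have tt q : msym t (msym t q) = q by rewrite -msymMm tperm2 msym1m.
have := dunklU_swap (msym t p) ji; rewrite tt => ->.
by rewrite msymD tt msymZ tt addrK.
Qed.

End DunklOperators.

(** * Change of coefficient ring *)

Section DunklMorphism.

Context (R S : idomainType) (N : nat) (f : {rmorphism R -> S}).
Implicit Types (i j : 'I_N) (p : {mpoly R[N]}).
Local Notation mapf := (map_mpoly f).

Lemma map_mpoly_sym (w : 'S_N) p : mapf (msym w p) = msym w (mapf p).
Proof. by apply/mpolyP=> b; rewrite !(mcoeff_sym, mcoeff_map_mpoly). Qed.

Lemma map_mpoly_deriv i p : mapf (mderiv i p) = mderiv i (mapf p).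
Proof.
by apply/mpolyP=> b; rewrite !(mcoeff_deriv, mcoeff_map_mpoly) raddfMn.
Qed.

Lemma map_mpoly_divdiff i j p : i != j ->
  mapf (divdiff i j p) = divdiff i j (mapf p).
Proof.
move=> ij; apply/esym/divdiff_unique => //; rewrite -map_mpoly_sym -rmorphB.
by rewrite -divdiffE rmorphM rmorphB /= !map_mpolyX.
Qed.

Lemma map_mpoly_dunkl k i p : mapf (dunkl k i p) = dunkl (f k) i (mapf p).
Proof.
rewrite /dunkl raddfD /= map_mpolyZ map_mpoly_deriv.
congr (_ + _ *: _); rewrite raddf_sum; apply: eq_bigr => j ji.
by rewrite /= map_mpoly_divdiff // eq_sym.
Qed.

Lemma map_mpoly_dunklU k i p : mapf (dunklU k i p) = dunklU (f k) i (mapf p).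
Proof.
rewrite /dunklU raddfB /= map_mpolyZ map_mpoly_dunkl rmorphM /= map_mpolyX.
congr (_ - _ *: _); rewrite raddf_sum.
by apply: eq_bigr => j _; exact: map_mpoly_sym.
Qed.

Lemma rmorph_xi k b i : f (xi k b i) = xi (f k) b i :> S.
Proof.
rewrite /xi; move: (comp_rank b i) => c.
by rewrite !rmorphD rmorphM rmorphB !rmorph_nat rmorph1.
Qed.

End DunklMorphism.

(** * Triangularity of the operators U_i *)

Section TopMonomial.

Context (N : nat).
Implicit Types (i j k : 'I_N) (b g : 'X_{1..N}).

(* Dividing by x_i - x_j moves two exponents closer together, which lowers the
   sum of squares, or exchanges them, which [mnm_wt] detects. *)
Definition mnm_sq b := (\sum_i b i * b i)%N.
Definition mnm_wt b := (\sum_i b i * (N - i))%N.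
Definition top_le g b :=
  ((mnm_sq g < mnm_sq b) || (mnm_sq g == mnm_sq b) && (mnm_wt g <= mnm_wt b))%N.

Definition mnm_upd2 g i j s t : 'X_{1..N} :=
  [multinom if k == i then s else if k == j then t else g k | k < N].

Lemma top_le_refl b : top_le b b.
Proof. by rewrite /top_le eqxx leqnn orbT. Qed.

Lemma exists_top_le_max (s : seq 'X_{1..N}) :
  s != [::] -> exists2 b, b \in s & {in s, forall g, top_le g b}.
Proof.
elim: s => // b s IHs _; have [->|/IHs[b' b's b'max]] := eqVneq s [::].
  by exists b; rewrite ?mem_head // => g; rewrite inE => /eqP ->;
    exact: top_le_refl.
case: (boolP (top_le b b')) => bb'.
  exists b'; rewrite ?in_cons ?b's ?orbT // => g.
  by rewrite in_cons => /predU1P[->|/b'max].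
exists b; rewrite ?mem_head // => g; rewrite in_cons => /predU1P[->|/b'max].
  exact: top_le_refl.
by move: bb'; rewrite /top_le; lia.
Qed.

Lemma mnm_sum_upd2 (F : 'I_N -> nat -> nat) g i j s t : i != j ->
  (\sum_k F k (mnm_upd2 g i j s t k) + F i (g i) + F j (g j) =
   \sum_k F k (g k) + F i s + F j t)%N.
Proof.
move=> ij; rewrite (bigD1 i) // [in RHS](bigD1 i) //=.
rewrite (bigD1 j) 1?eq_sym // [in RHS](bigD1 j) 1?eq_sym //=.
rewrite !mnmE eqxx [j == i]eq_sym (negPf ij) eqxx.
rewrite (eq_bigr (fun k => F k (g k))); first by lia.
by move=> k /andP[/negPf ki /negPf kj]; rewrite mnmE ki kj.
Qed.

Lemma mnm_upd2_sq g i j s t : i != j -> (s + t = g i + g j)%N ->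
  (s * s + t * t < g i * g i + g j * g j)%N -> ~~ top_le g (mnm_upd2 g i j s t).
Proof.
move=> ij _ lt_sq; have := mnm_sum_upd2 (fun _ x => x * x)%N g s t ij.
by rewrite /top_le -/(mnm_sq g) -/(mnm_sq (mnm_upd2 g i j s t)); lia.
Qed.

Lemma mnm_upd2_wt g i j : (i < j)%N -> (g j < g i)%N ->
  ~~ top_le g (mnm_upd2 g i j (g j) (g i)).
Proof.
move=> ij lt_g; have neq_ij : i != j by rewrite -val_eqE neq_ltn ij.
have := mnm_sum_upd2 (fun _ x => x * x)%N g (g j) (g i) neq_ij.
have := mnm_sum_upd2 (fun k x => x * (N - k))%N g (g j) (g i) neq_ij.
rewrite /top_le -/(mnm_sq g) -/(mnm_sq (mnm_upd2 _ _ _ _ _)).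
rewrite -/(mnm_wt g) -/(mnm_wt (mnm_upd2 _ _ _ _ _)).
have := ltn_ord j; nia.
Qed.

Lemma mnm_upd2_id g i j : mnm_upd2 g i j (g i) (g j) = g.
Proof. by apply/mnmP=> k; rewrite mnmE; case: eqP => [->|_] //;
  case: eqP => [->|]. Qed.

Lemma mnm_upd2C g i j s t : i != j -> mnm_upd2 g i j s t = mnm_upd2 g j i t s.
Proof.
by move=> ij; apply/mnmP=> k; rewrite !mnmE; case: eqP => [->|_] //;
  rewrite (negPf ij).
Qed.

Lemma mnm_upd2_tperm g i j :
  [multinom g (tperm i j k) | k < N] = mnm_upd2 g i j (g j) (g i).
Proof.
apply/mnmP=> k; rewrite !mnmE;
  case: tpermP => [->|->|/eqP/negPf -> /eqP/negPf ->] //.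
  by rewrite eqxx.
by rewrite eqxx; case: eqP => // ->.
Qed.

Context (R : idomainType).

Lemma mpolyX_upd2 g i j s t : i != j ->
  'X_[mnm_upd2 g i j s t] =
  'X_i ^+ s * 'X_j ^+ t * 'X_[mnm_upd2 g i j 0 0] :> {mpoly R[N]}.
Proof.
move=> ij; rewrite !mpolyXn -!mpolyXD; congr 'X_[_]; apply/mnmP=> k.
rewrite !(mnmDE, mulmnE, mnmE) !(eq_sym k); case: eqP => [<-|_] //=.
  by rewrite eq_sym (negPf ij) mul1n mul0n !addn0.
by case: eqP => _; rewrite ?mul1n ?mul0n ?addn0.
Qed.

(** With x = x_i and y = x_j the numerator is a monomial times a difference of two powers, hence a
    geometric sum. If g_j <= g_i it runs from x^g to its exchange, both included; otherwise only
    exponents strictly between them occur, with a minus sign. *)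
Lemma divdiffX i j g : i != j ->
  divdiff i j ('X_i * 'X_[g]) =
  if (g j <= g i)%N
  then \sum_(t < (g i - g j).+1) 'X_[mnm_upd2 g i j (g i - t) (g j + t)]
  else - \sum_(t < (g j - g i).-1)
          'X_[mnm_upd2 g i j (g j - t.+1) (g i + t.+1)] :> {mpoly R[N]}.
Proof.
move=> ij; apply: divdiff_unique => //.
set x : {mpoly R[N]} := 'X_i; set y : {mpoly R[N]} := 'X_j.
set r : {mpoly R[N]} := 'X_[mnm_upd2 g i j 0 0].
have Xg : 'X_[g] = x ^+ g i * y ^+ g j * r by rewrite -mpolyX_upd2 // mnm_upd2_id.
have -> : msym (tperm i j) (x * 'X_[g]) = y * (x ^+ g j * y ^+ g i * r).
  rewrite msymM msymXi tpermL -mpolyX_upd2 // msymX; congr (_ * 'X_[_]).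
  by rewrite tpermV mnm_upd2_tperm.
rewrite Xg; case: leqP => le_g.
  rewrite (eq_bigr (fun t : 'I__ => (x * y) ^+ g j *
             (x ^+ ((g i - g j).+1.-1 - t) * y ^+ t) * r)); last first.
    move=> t _; rewrite mpolyX_upd2 // -/x -/y -/r exprMn exprD.
    have -> : (g i - t = g j + ((g i - g j).+1.-1 - t))%N by have := ltn_ord t;
      lia.
    by rewrite exprD; ring.
  rewrite -mulr_suml -mulr_sumr mulrA mulrCA -subrXX.
  rewrite [RHS](_ : _ = (x ^+ (g i).+1 * y ^+ g j - x ^+ g j * y ^+
    (g i).+1) * r).
    have -> : (g i).+1 = (g j + (g i - g j).+1)%N by lia.
    by rewrite !exprD exprMn; ring.
  by rewrite !exprS; ring.
rewrite (eq_bigr (fun t : 'I__ => (x * y) ^+ (g i).+1 *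
           (x ^+ ((g j - g i).-1.-1 - t) * y ^+ t) * r)); last first.
  move=> t _; rewrite mpolyX_upd2 // -/x -/y -/r exprMn.
  have -> : (g j - t.+1 = (g i).+1 + ((g j - g i).-1.-1 - t))%N by have :=
    ltn_ord t; lia.
  by rewrite addnS -addSn !exprD; ring.
rewrite mulrN -mulr_suml -mulr_sumr; set S := \sum_(_ < _) _.
transitivity (- ((x * y) ^+ (g i).+1 * ((x - y) * S) * r)); first by ring.
rewrite /S -subrXX.
rewrite [RHS](_ : _ = (x ^+ (g i).+1 * y ^+ g j - x ^+ g j * y ^+ (g i).+1) * r).
  have [c gjE] : exists c, g j = ((g i).+1 + c)%N by exists (g j - g i).-1; lia.
  have -> : (g j - g i).-1 = c by lia.
  by rewrite gjE !exprD exprMn; ring.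
by rewrite !exprS; ring.
Qed.

(** Up to the factor [kap] this is the contribution of j to the coefficient of x^b in U_i x^g.
    Interior monomials of the geometric sum have a smaller sum of squares than g, so they are not b;
    the exchanged monomial, if it occurs and differs from g, cancels against the transposition or is
    lower than g. What is left is diagonal. *)
Lemma mcoeff_divdiffX i j g b : i != j -> top_le g b ->
  (divdiff i j ('X_i * 'X_[g]))@_b
    - (if (j < i)%N then (msym (tperm j i) 'X_[g])@_b else 0) =
  ((g == b) && ((b j < b i) || (b j == b i) && (i < j))%N)%:R :> R.
Proof.
move=> ij gb; rewrite msymX tpermV mcoeffX tpermC mnm_upd2_tperm divdiffX //.
have inner s t : (s + t = g i + g j)%N ->
  (s * s + t * t < g i * g i + g j * g j)%N ->
    (mnm_upd2 g i j s t == b) = false.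
  move=> st lt_sq; apply: contraTF gb => /eqP <-; exact: mnm_upd2_sq.
have swap : (j < i)%N -> (g i < g j)%N ->
  (mnm_upd2 g i j (g j) (g i) == b) = false.
  move=> ji lt_g; apply: contraTF gb => /eqP <-.
  by rewrite mnm_upd2C //; exact: mnm_upd2_wt.
have swap' : (i < j)%N -> (g j < g i)%N ->
  (mnm_upd2 g i j (g j) (g i) == b) = false.
  by move=> lt_ij lt_g; apply: contraTF gb => /eqP <-; exact: mnm_upd2_wt.
have -> : (if (g j <= g i)%N
  then \sum_(t < (g i - g j).+1) 'X_[mnm_upd2 g i j (g i - t) (g j + t)]
  else - \sum_(t < (g j - g i).-1) 'X_[mnm_upd2 g i j (g j - t.+1) (g i + t.+1)]
     : {mpoly R[N]})@_b = ((g j <= g i)%N && (g == b))%:R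
      + ((g j < g i)%N && (mnm_upd2 g i j (g j) (g i) == b))%:R.
  have [lt_g|lt_g|eq_g] := ltngtP (g j) (g i).
  - have [c gc] : exists c, (g i - g j = c.+1)%N by exists (g i - g j).-1; lia.
    rewrite gc big_ord_recl big_ord_recr /= subn0 addn0 mnm_upd2_id.
    have -> : (g i - bump 0 c = g j)%N by rewrite /bump /=; lia.
    have -> : (g j + bump 0 c = g i)%N by rewrite /bump /=; lia.
    rewrite !mcoeffD !mcoeffX raddf_sum big1 ?add0r // => t _.
    by rewrite /= mcoeffX inner // /bump /=; have := ltn_ord t; [lia|nia].
  - rewrite mcoeffN raddf_sum big1 ?oppr0 ?addr0 // => t _.
    by rewrite /= mcoeffX inner //; have := ltn_ord t; [lia|nia].
  - rewrite eq_g subnn big_ord1 subn0 addn0 mcoeffX addr0.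
    by rewrite -{2}eq_g mnm_upd2_id.
have fixE : (mnm_upd2 g i j (g j) (g i) == g) = (g j == g i).
  apply/eqP/eqP => [/mnmP/(_ i)|gji]; first by rewrite mnmE eqxx.
  by rewrite gji -{2}gji mnm_upd2_id.
have [gE|neq_gb] := eqVneq g b.
  rewrite -gE fixE; case: (ltngtP (g j) (g i)) => _ /=;
    rewrite ?if_same ?addr0 ?subr0 //.
  by case: (ltngtP i j) => [_|_|/val_inj/eqP];
    rewrite ?subr0 ?subrr // (negPf ij).
rewrite andbF add0r /=; have [lt_g|lt_g|eq_g] /= := ltngtP (g j) (g i).
- have [ji|ji] := ltnP j i; first by rewrite subrr.
  by rewrite swap' ?subr0 // ltn_neqAle ji andbT val_eqE.
- by case: ifP => [ji|_]; rewrite ?swap // subrr.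
- have /eqP -> : mnm_upd2 g i j (g j) (g i) == g by rewrite fixE eq_g.
  by rewrite (negPf neq_gb) if_same subrr.
Qed.

(** The coefficient N - r(b, i) in xi_i(b) counts the indices ranked after i, which are exactly
    those with a diagonal term in [mcoeff_divdiffX]. *)
Lemma comp_rankE b i :
  N = (comp_rank b i +
       \sum_(j < N | j != i) ((b j < b i) || (b j == b i) && (i < j)))%N.
Proof.
rewrite -{1}(card_ord N) -sum1_card /comp_rank -!sum1dep_card.
rewrite [X in (X + _ + _)%N]big_mkcond [X in (_ + X + _)%N]big_mkcond.
rewrite [X in (_ + X)%N]big_mkcond -!big_split /=; apply: eq_bigr => j _.
have [->|] := eqVneq j i; first by rewrite ltnn leqnn eqxx.
by rewrite -val_eqE /=; do 2 case: ifP; lia.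
Qed.

Variable kap : R.

Lemma mcoeff_dunklUX i g b : top_le g b ->
  (dunklU kap i 'X_[g])@_b = (g == b)%:R * xi kap b i.
Proof.
move=> gb; rewrite /dunklU /dunkl mcoeffB mcoeffD !mcoeffZ -addrA -mulrBr.
have diagE : (mderiv i ('X_i * 'X_[g] :
  {mpoly R[N]}))@_b = (g == b)%:R * (b i)%:R + (g == b)%:R.
  rewrite -mpolyXD mderivX mcoeffZ mcoeffX mnmDE mnm1E eqxx addmC addmK.
  by case: eqVneq => [->|_];
    rewrite ?mulr0 ?mul0r ?addr0 // mulr1 mul1r natrD addrC.
rewrite {}diagE; have ->
  : (\sum_(j < N | j != i) divdiff i j ('X_i * 'X_[g]))@_b -
  (\sum_(j < N | (j < i)%N) msym (tperm j i) 'X_[g])@_b =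
  (g == b)%:R * (N%:R - (comp_rank b i)%:R) :> R; last by rewrite /xi; ring.
rewrite !raddf_sum /=.
have -> : \sum_(j < N | (j < i)%N) - (msym
  (tperm j i) 'X_[g])@_b = \sum_(j < N | j != i)
     - (if (j < i)%N then (msym (tperm j i) 'X_[g])@_b else 0) :> R.
  rewrite [LHS]big_mkcond [RHS]big_mkcond /=; apply: eq_bigr => j _.
  by rewrite -val_eqE /=; case: ltngtP; rewrite ?oppr0.
rewrite -big_split (eq_bigr (fun j => (g == b)%:R *
    ((b j < b i) || (b j == b i) && (i < j))%N%:R)); last first.
  by move=> j ji; rewrite /= mcoeff_divdiffX 1?eq_sym // -mulnb natrM.
rewrite -mulr_sumr -natr_sum; congr (_ * _).
by rewrite (congr1 (fun n => n%:R : R) (comp_rankE b i)) natrD addrC addKr.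
Qed.

Lemma mcoeff_dunklU_top i p b : {in msupp p, forall g, top_le g b} ->
  (dunklU kap i p)@_b = xi kap b i * p@_b.
Proof.
move=> b_max; rewrite {1 2}[p]mpolyE.
have dunklU0 : dunklU kap i 0 = 0.
  by have := dunklUZ kap i 0 (0 : {mpoly R[N]}); rewrite !scale0r.
rewrite (big_morph _ (@dunklUD R N kap i) dunklU0) !raddf_sum mulr_sumr /=.
rewrite !big_seq; apply: eq_bigr => g g_p.
rewrite dunklUZ !mcoeffZ mcoeff_dunklUX ?b_max // mcoeffX; ring.
Qed.

(** At a maximal exponent b the coefficient of U_i p depends on [p@_b] alone, so every eigenvalue of
    p can be read off from b. The same b serves all i at once. *)
Lemma exists_top_monomial p : p != 0 ->
  exists2 b, (b \in msupp p) && all (top_le^~ b) (msupp p) &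
    forall i e, dunklU kap i p = e *: p -> e = xi kap b i.
Proof.
rewrite -msupp_eq0 => /exists_top_le_max[b b_p b_max].
exists b; first by rewrite b_p; apply/allP.
move=> i e /(congr1 (mcoeff b)); rewrite mcoeff_dunklU_top // mcoeffZ.
by move=> xiE; apply: (mulIf _ (esym xiE)); rewrite -mcoeff_msupp.
Qed.

End TopMonomial.

(** * Ranks and the spectrum of a rectangle *)

Section Ranks.

Context (N : nat).
Implicit Types (i j : 'I_N) (b : 'X_{1..N}).

Lemma comp_rank_sum b i :
  comp_rank b i = (\sum_(j < N) ((b i < b j) + ((j <= i) && (b j == b i))))%N.
Proof.
rewrite /comp_rank -!sum1dep_card big_split /= [X in (X + _)%N]big_mkcond.
rewrite [X in (_ + X)%N]big_mkcond; congr (_ + _)%N;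
  by apply: eq_bigr => j _; case: ifP.
Qed.

Lemma sum_ltn_ord k : (k <= N)%N -> (\sum_(j < N) (j < k) = k)%N.
Proof.
move=> kN; rewrite -[RHS]card_ord -sum1_card (big_ord_widen N (fun=> 1%N) kN).
by rewrite [RHS]big_mkcond; apply: eq_bigr => j _; case: ifP.
Qed.

Lemma comp_rank_gt0 b i : (0 < comp_rank b i)%N.
Proof. by rewrite comp_rank_sum (bigD1 i) //= ltnn leqnn eqxx. Qed.

Lemma comp_rank_leN b i : (comp_rank b i <= N)%N.
Proof.
rewrite comp_rank_sum -[leqRHS](sum_ltn_ord (leqnn N)); apply: leq_sum => j _.
by rewrite ltn_ord; lia.
Qed.

Lemma comp_rank_partition b i : (forall j k : 'I_N, (j <= k)%N ->
  (b k <= b j)%N) ->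
  comp_rank b i = i.+1.
Proof.
move=> b_part; rewrite comp_rank_sum -[RHS](sum_ltn_ord (ltn_ord i)).
apply: eq_bigr => j _; rewrite ltnS.
by case: (leqP j i) => [/b_part|/ltnW/b_part]; lia.
Qed.

Lemma comp_rank_eq_lt b i j : (i < j)%N -> b i = b j ->
  (comp_rank b i < comp_rank b j)%N.
Proof.
move=> ij eq_b; rewrite !comp_rank_sum (bigD1 j) //= [ltnRHS](bigD1 j) //= eq_b.
have -> : (j <= i)%N = false by rewrite leqNgt ij.
rewrite ltnn eqxx leqnn ltnS; apply: leq_sum => k _.
by case: eqP => // _; lia.
Qed.

End Ranks.

(** The form in which the gcd condition is used, with M = mu + 1: M divides gcd(m, M) x, which is at
    most n gcd(m, M) and so smaller than M. *)
Lemma dvdn_gcd_small m M n x :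
  (n * gcdn m M < M)%N -> (x <= n)%N -> (M %| m * x)%N -> x = 0%N.
Proof.
move=> lt_nM le_xn M_mx; apply/eqP; rewrite -leqn0 leqNgt; apply/negP => x_gt0.
have : (M %| gcdn m M * x)%N by rewrite muln_gcdl dvdn_gcd M_mx dvdn_mulr.
have g_gt0 : (0 < gcdn m M)%N by rewrite gcdn_gt0 (leq_ltn_trans _ lt_nM) ?orbT.
move/(dvdn_leq (_ : 0 < gcdn m M * x)%N);
  rewrite muln_gt0 x_gt0 g_gt0 => /(_ isT).
by rewrite leqNgt (leq_ltn_trans _ lt_nM) // mulnC leq_mul2r le_xn orbT.
Qed.

Section RectangleSpectrum.

Context (N mu m : nat).
Hypotheses (mu_gt0 : (0 < mu)%N) (m_gt0 : (0 < m)%N) (le_Nmu : (N - mu <= mu)%N).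
Hypotheses (lt_muN : (mu < N)%N) (gcd_lt : ((N - mu) * gcdn m mu.+1 < mu.+1)%N).

Local Notation lambda := [multinom (if (i < N - mu)%N then m else 0%N) | i < N].
Local Notation k0 := (- (m%:R / mu.+1%:R) : rat).

Lemma comp_rank_rect i : comp_rank lambda i = i.+1.
Proof. by apply: comp_rank_partition => j k jk; rewrite !mnmE;
  do 2 case: ifP => //; lia. Qed.

Lemma xi_eq_nat (b : 'X_{1..N}) i (c r : nat) :
  xi k0 b i = (N%:R - r%:R) * k0 + c%:R + 1 ->
  (mu.+1 * b i + m * comp_rank b i = mu.+1 * c + m * r)%N.
Proof.
rewrite /xi => /eqP eq_xi; apply/eqP;
  rewrite -(Num.Theory.eqr_nat rat) !natrD !natrM.
move: eq_xi; rewrite -subr_eq0 => /eqP eq_xi; rewrite -subr_eq0; apply/eqP.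
transitivity (mu.+1%:R * 0 : rat); last by rewrite mulr0.
rewrite -eq_xi; field. by rewrite nat1r Num.Theory.pnatr_eq0.
Qed.

Lemma rect_spectrum_unique (b : 'X_{1..N}) :
  (forall i, xi k0 b i = xi k0 lambda i) -> b = lambda.
Proof.
move=> xi_b; have le_nmu := le_Nmu; have gcd_lt_n := gcd_lt.
set n := (N - mu)%N in le_nmu gcd_lt_n *.
have eq_b i : (mu.+1 * b i + m * comp_rank b i = mu.+1 * lambda i + m * i.+1)%N.
  by apply: xi_eq_nat; rewrite xi_b /xi comp_rank_rect.
have nN : (n < N)%N by rewrite /n; lia.
(* At the first index n outside A the equation reads (mu + 1) b_n = m (n + 1 - r), and divisibility
   forces r = n + 1 and b_n = 0. *)
have bn (i : 'I_N) : i = n :> nat -> b i = 0%N /\ comp_rank b i = n.+1.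
  move=> i_n; move: (eq_b i) (comp_rank_gt0 b i);
    rewrite mnmE i_n ltnn muln0 => eq_bi r_gt0.
  have le_r : (comp_rank b i <= n.+1)%N by nia.
  have Mb : (mu.+1 * b i = m * (n.+1 - comp_rank b i))%N by nia.
  have: (n.+1 - comp_rank b i = 0)%N.
    by apply: (dvdn_gcd_small gcd_lt_n); [lia|rewrite -Mb dvdn_mulr].
  by move: Mb; nia.
have [bn0 rn] := bn (Ordinal nN) erefl.
(* Since b_n = 0, all indices up to n already count towards its rank n + 1; a positive entry further
   on would make the rank larger. *)
have b_supp (j : 'I_N) : (n <= j)%N -> b j = 0%N.
  rewrite leq_eqVlt => /predU1P[/esym/bn[]//|nj]; apply/eqP;
    apply: contraTT (leqnn n.+1).
  rewrite -lt0n -ltnNge => bj_gt0; rewrite -{2}rn comp_rank_sum bn0 /=.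
  rewrite -{1}(sum_ltn_ord nN) (bigD1 j) //= [ltnRHS](bigD1 j) //=.
  rewrite bj_gt0 ltnS (leqNgt j) nj /= add0n addn0 ltnS.
  by apply: leq_sum => k _; lia.
have n_gt0 : (0 < n)%N by rewrite /n; lia.
have cN : (n.-1 < N)%N by lia.
pose c := Ordinal cN.
have := eq_b c; rewrite mnmE /= ltn_predL n_gt0 prednK // => eq_c.
(* The rank is at most N = mu + n, so the equation at c leaves (mu + 1) b_c >= m > 0. *)
have bc_gt0 : (0 < b c)%N.
  have := comp_rank_leN b c; have : (N = mu + n)%N by rewrite /n; lia.
  nia.
have le_n (j : 'I_N) (a : nat) k : (0 < a)%N ->
    ((a < b j) + ((j <= k)%N && (b j == a)) <= (j < n))%N.
  by move=> a_gt0; have [_|/b_supp] := ltnP j n; lia.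
have rc_le : (comp_rank b c <= n)%N.
  rewrite comp_rank_sum -[leqRHS](sum_ltn_ord (ltnW nN)); apply: leq_sum => j _.
  exact: le_n.
have Mbc : (mu.+1 * (b c - m) = m * (n - comp_rank b c))%N by nia.
have rc : (n - comp_rank b c = 0)%N.
  by apply: (dvdn_gcd_small gcd_lt_n); [lia|rewrite -Mbc dvdn_mulr].
have bc : b c = m by nia.
(* The index c has rank n and only indices in A have positive entries, so none of these n entries
   may be smaller than b_c = m. *)
have b_ge (j : 'I_N) : (j < n)%N -> (m <= b j)%N.
  move=> jn; rewrite leqNgt; apply/negP => lt_bj;
    have: (n <= comp_rank b c)%N by lia.
  apply/negP; rewrite -ltnNge comp_rank_sum bc -[ltnRHS](sum_ltn_ord (ltnW nN)).
  rewrite (bigD1 j) //= [ltnRHS](bigD1 j) //= jn.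
  have [-> ->] : (m < b j)%N = false /\ (b j == m) = false by lia.
  by rewrite andbF ltnS; apply: leq_sum => k _; exact: le_n.
apply/mnmP => i; rewrite mnmE; case: ltnP => [i_n|/b_supp //].
have := eq_b i; rewrite mnmE i_n => eq_bi; have := comp_rank_gt0 b i => r_gt0.
have le_bi := b_ge i i_n.
have le_r : (comp_rank b i <= i.+1)%N by nia.
have Mbi : (mu.+1 * (b i - m) = m * (i.+1 - comp_rank b i))%N by nia.
have: (i.+1 - comp_rank b i = 0)%N.
  by apply: (dvdn_gcd_small gcd_lt_n); [lia|rewrite -Mbi dvdn_mulr].
nia.
Qed.

End RectangleSpectrum.

(** * Absence of a pole at k0 *)

Lemma map_mpoly_inj (R S : nzRingType) (N : nat) (f : {rmorphism R -> S}) :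
  injective f -> injective (map_mpoly (n := N) f).
Proof.
move=> f_inj p q eq_pq; apply/mpolyP=> b; apply: f_inj.
by rewrite -!mcoeff_map_mpoly eq_pq.
Qed.

Lemma fraction_eq (R : idomainType) (c : {fraction R}) :
  exists n d : R, d != 0 /\ c * tofrac d = tofrac n.
Proof.
elim/quotW: c => x; exists \n_x, \d_x; split; first exact: denom_ratioP.
unlock tofrac; rewrite -[LHS]FracField.pi_mul; apply/eqmodP.
rewrite /= FracField.equivfE /FracField.mulf /=.
by rewrite !numden_Ratio ?(oner_eq0, mulr1, denom_ratioP) // mulrC.
Qed.

Lemma mpoly_clear_denominators (R : idomainType) (N : nat) (p :
  {mpoly {fraction R}[N]}) :
  exists (q : {mpoly R[N]}) (d : R),
    d != 0 /\ map_mpoly (@tofrac R) q = tofrac d *: p.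
Proof.
elim/mpolyind: p => [|c b p _ _ [q [d [d0 qE]]]].
  by exists 0, 1; rewrite oner_eq0 raddf0 scaler0.
have [n [e [e0 cE]]] := fraction_eq c.
exists ((d * n) *: 'X_[b] + e *: q), (d * e); split; first by rewrite mulf_neq0.
rewrite raddfD /= !map_mpolyZ map_mpolyX qE !rmorphM /= -cE scalerDr !scalerA.
by congr (_ *: _ + _ *: _); ring.
Qed.

Section Specialization.

Context (N : nat) (a : 'X_{1..N}) (zeta : {mpoly Qkappa[N]}) (k0 : rat).
Hypothesis zetaP : is_jack a zeta.
Hypothesis uniq_xi : forall b, (forall i, xi k0 b i = xi k0 a i) -> b = a.

Local Notation ev := (horner_eval k0).
Local Notation tf := (@tofrac {poly rat}).

Lemma eigen_of_multiple (P : {mpoly {poly rat}[N]}) (c : Qkappa) i :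
  map_mpoly tf P = c *: zeta -> dunklU 'X i P = xi 'X a i *: P.
Proof.
move=> PE; have [_ _ Uzeta] := zetaP.
have tf_inj : injective tf by move=> p q /eqP; rewrite tofrac_eq => /eqP.
apply: (map_mpoly_inj tf_inj); rewrite map_mpoly_dunklU map_mpolyZ PE.
rewrite rmorph_xi dunklUZ Uzeta !scalerA; congr (_ *: _); exact: mulrC.
Qed.

Lemma eigen_at (P : {mpoly {poly rat}[N]}) i :
  dunklU 'X i P = xi 'X a i *: P ->
  dunklU k0 i (map_mpoly ev P) = xi k0 a i *: map_mpoly ev P.
Proof.
move=> /(congr1 (map_mpoly ev)).
by rewrite map_mpoly_dunklU map_mpolyZ rmorph_xi /= /horner_eval hornerX.
Qed.

(** Induction on the multiplicity of ['X - k0%:P] in a common denominator. While it is positive, the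
    polynomial multiple P of zeta loses its x^a term at [k0]; by [uniq_xi] its value there cannot be
    a nonzero eigenvector, so P is divisible by ['X - k0%:P] and one factor cancels. *)
Lemma no_pole_multiple :
  exists (P : {mpoly {poly rat}[N]}) (Q : {poly rat}),
    Q.[k0] != 0 /\ map_mpoly tf P = tf Q *: zeta.
Proof.
have [P [d [d0 PE]]] := mpoly_clear_denominators zeta.
have [e [Q]] := multiplicity_XsubC d k0; rewrite d0 /= => Qk0 dE.
rewrite dE in PE; elim: e P PE {dE} => [|e IHe] P PE.
  by exists P, Q; rewrite -[_ == _]/(root Q k0) Qk0 PE expr0 mulr1.
have P0 : map_mpoly ev P = 0.
  apply/eqP; apply: contraT => /(exists_top_monomial k0)[b /andP[b_P _]] b_xi.
  have ba : b = a.
    apply: uniq_xi => i; apply/esym/b_xi/eigen_at/eigen_of_multiple; exact: PE.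
  move: b_P; rewrite mcoeff_msupp ba mcoeff_map_mpoly.
  have [zeta_a _ _] := zetaP; have := congr1 (mcoeff a) PE.
  rewrite mcoeff_map_mpoly mcoeffZ zeta_a mulr1 => /eqP;
    rewrite tofrac_eq => /eqP ->.
  by rewrite /= /horner_eval exprS !hornerM hornerXsubC subrr mul0r mulr0 eqxx.
have [P' P'E] : exists P', P = ('X - k0%:P) *: P'.
  exists (\sum_(b <- msupp P) (P@_b %/ ('X - k0%:P)) *: 'X_[b]).
  rewrite {1}[P]mpolyE scaler_sumr; apply: eq_bigr => b _.
  rewrite scalerA mulrC divpK // dvdp_XsubCl /root.
  by rewrite -[_.[_]]/(ev _) -mcoeff_map_mpoly P0 mcoeff0.
have /IHe // : map_mpoly tf P' = tf (Q * ('X - k0%:P) ^+ e) *: zeta.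
have X0 : tf ('X - k0%:P) != 0 by rewrite tofrac_eq0 polyXsubC_eq0.
apply: (scalerI X0); rewrite -map_mpolyZ -P'E PE scalerA -rmorphM exprS.
by rewrite mulrCA.
Qed.

Lemma xi_polyX_inj (b : 'X_{1..N}) i j :
  xi ('X : {poly rat}) b i = xi 'X a j ->
    b i = a j /\ comp_rank b i = comp_rank a j.
Proof.
move=> eq_xi.
have eq0 : (b i)%:R + 1 = (a j)%:R + 1 :> rat.
  have := congr1 (horner_eval (0 : rat)) eq_xi.
  by rewrite !rmorph_xi /= /horner_eval hornerX /xi !mulr0 !add0r.
have eq1 : (N%:R - (comp_rank b i)%:R) + (b i)%:R + 1 =
           (N%:R - (comp_rank a j)%:R) + (a j)%:R + 1 :> rat.
  have := congr1 (horner_eval (1 : rat)) eq_xi.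
  by rewrite !rmorph_xi /= /horner_eval hornerX /xi !mulr1.
have eq_v := addIr 1 eq0; rewrite eq_v in eq1.
split; apply/eqP; rewrite -(Num.Theory.eqr_nat rat); first exact/eqP.
by move/addIr/addIr/addrI/oppr_inj/eqP: eq1.
Qed.

(** By [dunklU_swap] the difference [msym (tperm i j) P - P] is an eigenvector with the eigenvalues
    at i and j exchanged. If it were nonzero, its top exponent would have equal entries at i and j
    with ranks in decreasing order, contrary to [comp_rank_eq_lt]. *)
Lemma swap_invariant (P : {mpoly {poly rat}[N]}) (i j : 'I_N) :
  (forall k, dunklU 'X k P = xi 'X a k *: P) -> j = i.+1 :> nat ->
  a i = a j -> comp_rank a j = (comp_rank a i).+1 -> msym (tperm i j) P = P.
Proof.
move=> UP ji aij rij; apply/eqP; rewrite -subr_eq0; apply: contraT => nz_g.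
have xiij : xi 'X a i = xi 'X a j + 'X :> {poly rat}.
  by rewrite /xi rij aij -natr1; ring.
have [b _ b_xi] := exists_top_monomial 'X nz_g.
have dB k p q : dunklU 'X k
  (p - q) = dunklU 'X k p - dunklU 'X k q :> {mpoly {poly rat}[N]}.
  by rewrite dunklUD -scaleN1r dunklUZ scaleN1r.
have /b_xi xi_i : dunklU 'X i (msym (tperm i j) P - P) = xi 'X a j *: (msym
  (tperm i j) P - P).
  rewrite dB dunklU_swap // !UP msymZ xiij; move: (xi _ _ _) => x.
  by rewrite scalerDl scalerBr opprD addrACA subrr addr0.
have /b_xi xi_j : dunklU 'X j (msym (tperm i j) P - P) = xi 'X a i *: (msym
  (tperm i j) P - P).
  rewrite dB dunklU_swapS // !UP msymZ xiij; move: (xi _ _ _) => x.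
  by rewrite (scalerBr (x + _)) -addrA -opprD [_ + x *: _]addrC -scalerDl.
have [bi rbi] := xi_polyX_inj (esym xi_i);
  have [bj rbj] := xi_polyX_inj (esym xi_j).
have := @comp_rank_eq_lt _ b i j; rewrite rbi rbj rij ji bi bj aij.
by move=> /(_ (leqnn _) erefl); lia.
Qed.

Lemma jack_specialization :
  exists f : {mpoly rat[N]}, [/\ specializes k0 zeta f, f@_a = 1,
    forall b, b \in msupp f -> mdeg b = mdeg a,
    forall i, dunklU k0 i f = xi k0 a i *: f &
    forall i j : 'I_N, j = i.+1 :> nat -> a i = a j ->
      comp_rank a j = (comp_rank a i).+1 -> msym (tperm i j) f = f].
Proof.
have [P [Q [Qk0 PE]]] := no_pole_multiple; have [za z_supp _] := zetaP.
have UP i := eigen_of_multiple i PE.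
have Pb b : tf P@_b = tf Q * zeta@_b by rewrite -mcoeffZ -PE mcoeff_map_mpoly.
have Q0 : tf Q != 0.
  by rewrite tofrac_eq0; apply: contraNneq Qk0 => ->; rewrite horner0.
(* Dividing by the value of Q makes the specialization x-monic like zeta. *)
exists (Q.[k0]^-1 *: map_mpoly ev P); split.
- move=> b; exists P@_b, Q; split=> //; first by rewrite Pb mulrC mulKf.
  by rewrite mcoeffZ mcoeff_map_mpoly mulrC.
- rewrite mcoeffZ mcoeff_map_mpoly; have := Pb a; rewrite za mulr1 => /eqP.
  by rewrite tofrac_eq => /eqP ->; rewrite mulVf.
- move=> b /msuppZ_le; rewrite mcoeff_msupp mcoeff_map_mpoly => fb.
  have zb : b \in msupp zeta.
    rewrite mcoeff_msupp; apply: contraNneq fb => zb0; have := Pb b.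
    rewrite zb0 mulr0 => /eqP; rewrite tofrac_eq0 => /eqP ->.
    by rewrite raddf0.
  have [-> //|ba] := eqVneq b a.
  by have /andP[/eqP] := z_supp b zb ba.
- by move=> i; rewrite dunklUZ eigen_at // scalerA mulrC -scalerA.
- by move=> i j ji aij rij; rewrite msymZ -map_mpoly_sym (swap_invariant UP).
Qed.

End Specialization.

(** * Singularity *)

Definition young_stab (N n : nat) : pred 'S_N :=
  [pred w : 'S_N | [forall i : 'I_N, (w i < n)%N == (i < n)%N]].

Arguments young_stab : clear implicits.

Lemma young_stabP (N n : nat) (w : 'S_N) :
  reflect (forall i, (w i < n)%N = (i < n)%N) (w \in young_stab N n).
Proof. by rewrite inE; apply: (iffP forallP) => h i;
  [move/eqP: (h i)|rewrite h]. Qed.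

(** * From adjacent transpositions to the Young subgroup *)

Section YoungInvariance.

Context (R : idomainType) (N n : nat) (f : {mpoly R[N]}).
Hypothesis f_adj : forall i j : 'I_N, j = i.+1 :> nat -> (i < n)%N = (j < n)%N ->
  msym (tperm i j) f = f.

Lemma msym_tperm_young (i j : 'I_N) : (i < n)%N = (j < n)%N ->
  msym (tperm i j) f = f.
Proof.
wlog le_ij : i j / (i <= j)%N.
  move=> wl eq_n; have [/wl|/ltnW/wl] := leqP i j; first exact.
  by rewrite tpermC; apply.
have [d] : exists d, (j = i + d :> nat)%N by exists (j - i)%N; lia.
elim: d j {le_ij} => [|d IHd] j.
  by rewrite addn0 => /val_inj ->; rewrite tperm1 msym1m.
move=> jE eq_n; have lt_j' : (i + d < N)%N by have := ltn_ord j; lia.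
pose j' := Ordinal lt_j'.
have jj' : j = j'.+1 :> nat by rewrite /= jE addnS.
have n_j' : (j' < n)%N = (j < n)%N by move: eq_n; rewrite jE /=; lia.
have [-> // | ij'] := eqVneq i j'; first exact: f_adj.
(* (i, j) is the shorter transposition (i, j') conjugated by the adjacent one (j', j), and both stay
   within a block. *)
have -> : tperm i j = (tperm i j' ^ tperm j' j)%g.
  by rewrite tpermJ tpermL tpermD // -?val_eqE /= ?jE; move: ij';
    rewrite -val_eqE /=; lia.
rewrite conjgE tpermV !msymMm f_adj // IHd // ?f_adj //.
by rewrite eq_n n_j'.
Qed.

(** Induction on the number of moved points: following w by the transposition of x and w x fixes x
    and keeps all fixed points of w. *)
Lemma msym_young (w : 'S_N) : w \in young_stab N n -> msym w f = f.
Proof.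
have [d] := ubnP #|[set x | w x != x]|; elim: d w => // d IHd w.
rewrite ltnS => le_d /young_stabP w_n.
have [w_id | /existsP[x wx]] := boolP [forall x, w x == x].
  suff -> : w = 1%g by rewrite msym1m.
  by apply/permP => x; rewrite perm1; apply/eqP/(forallP w_id).
pose t := tperm x (w x); have tn i : (t i < n)%N = (i < n)%N.
  by rewrite /t; case: tpermP => // ->; rewrite w_n.
have wE : w = (w * t * t)%g by rewrite -mulgA tperm2 mulg1.
rewrite wE msymMm IHd ?msym_tperm_young ?w_n //; last first.
  by apply/young_stabP => i; rewrite permM tn.
apply: leq_trans le_d; apply: proper_card; apply/properP; split; last first.
  by exists x; rewrite !inE // permM tpermR eqxx.
apply/subsetP => y; rewrite !inE permM; apply: contraNneq => wy; rewrite wy.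
rewrite tpermD //; first by apply: contraNneq wx => ->; rewrite wy.
by apply: contraNneq wx => wxy; apply/eqP/(@perm_inj _ w); rewrite wxy wy.
Qed.

End YoungInvariance.

Lemma mpolyX_neq0 (R : nzRingType) (N : nat) (b : 'X_{1..N}) : 'X_[R, b] != 0.
Proof. by rewrite -msupp_eq0 msuppX. Qed.

Section Singular.

Context (N mu m : nat).
Hypotheses (mu_gt0 : (0 < mu)%N) (m_gt0 : (0 < m)%N) (le_Nmu : (N - mu <= mu)%N).
Hypotheses (lt_muN : (mu < N)%N) (gcd_lt : ((N - mu) * gcdn m mu.+1 < mu.+1)%N).

Local Notation lambda := [multinom (if (i < N - mu)%N then m else 0%N) | i < N].
Local Notation n := (N - mu)%N.

Context (k0 : rat) (f : {mpoly rat[N]}).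
Hypothesis k0E : k0 = - (m%:R / mu.+1%:R).
Hypothesis f_young : forall w, w \in young_stab N n -> msym w f = f.
Hypothesis Uf : forall i, dunklU k0 i f = xi k0 lambda i *: f.

Lemma msym_young_tperm (i j : 'I_N) : (i < n)%N = (j < n)%N ->
  msym (tperm i j) f = f.
Proof. by move=> eq_n; apply: f_young; apply/young_stabP => k;
  case: tpermP => // ->. Qed.

Lemma last_in_A : (n.-1 < N)%N. Proof. lia. Qed.
Lemma last_in_N : (N.-1 < N)%N. Proof. lia. Qed.
Local Notation c := (Ordinal last_in_A).
Local Notation l := (Ordinal last_in_N).

(** At the last index no transposition remains in U_l, and xi_l(lambda) = 1 makes
    ['X_l * dunkl k0 l f] vanish. The other indices outside A follow by invariance of f. *)
Lemma dunkl_zero_part (j : 'I_N) : (n <= j)%N -> dunkl k0 j f = 0.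
Proof.
move=> nj; have Dl : dunkl k0 l f = 0.
  have := Uf l; rewrite dunklUE big_pred0 ?scaler0 ?addr0; last first.
    by move=> k /=; have := ltn_ord k; lia.
  have -> : xi k0 lambda l = 1.
    rewrite /xi comp_rank_rect // mnmE /= ltnNge; have -> : (n <= N.-1)%N by lia.
    by rewrite prednK ?subrr ?mul0r ?add0r //; lia.
  rewrite scale1r => /eqP; rewrite -subr_eq0 addrK mulf_eq0 => /orP[|/eqP //].
  by rewrite (negPf (mpolyX_neq0 _ _)).
have := msym_dunkl k0 (tperm l j) l f;
  rewrite Dl msym0 tpermL msym_young_tperm /=; first exact: esym.
by lia.
Qed.

Let h := f + \sum_(j < N | (n <= j)%N) msym (tperm c j) f.

(** The indices after c are exactly those outside A, and xi_c(lambda) = mu k0 + m + 1 = 1 - k0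
    because (mu + 1) k0 = - m. *)
Lemma mulX_dunkl_boundary : 'X_c * dunkl k0 c f = - k0 *: h.
Proof.
have := Uf c; rewrite dunklUE.
rewrite (eq_bigl (fun j : 'I_N => n <= j)%N); last by move=> j /=; lia.
have -> : xi k0 lambda c = 1 - k0.
  rewrite /xi comp_rank_rect // mnmE /=; have -> : (n.-1 < n)%N by lia.
  have -> : n.-1.+1 = n by lia.
  rewrite natrB ?(ltnW lt_muN) //.
  by rewrite k0E; field; rewrite nat1r Num.Theory.pnatr_eq0.
rewrite -addrA => /(canRL (addrK _)) ->; rewrite /h.
by rewrite scaleNr scalerDr scalerBl scale1r opprD addrACA subrr add0r -opprD.
Qed.

(** The transposition (c, b) exchanges the terms f and (c, b) f of h, and fixes every other (c, j) f
    because (j, b) f = f. *)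
Lemma msym_boundary_sum (b : 'I_N) : (n <= b)%N -> msym (tperm c b) h = h.
Proof.
move=> nb; rewrite /h msymD raddf_sum /= (bigD1 b) //= -msymMm tperm2 msym1m.
rewrite addrCA [in RHS](bigD1 b) //=; congr (_ + (_ + _)).
apply: eq_bigr => j /andP[nj jb]; rewrite -msymMm.
have -> : (tperm c j * tperm c b = tperm j b * tperm c j)%g.
  rewrite [RHS]conjgC tpermJ tpermR tpermD //.
  by rewrite -val_eqE /=; lia.
by rewrite msymMm (@msym_young_tperm j b) //; lia.
Qed.

(** D_l annihilates f and every (c, j) f with j != l, so only (c, l) D_c f survives;
    [mulX_dunkl_boundary] and the symmetry of h then apply. *)
Lemma dunkl_boundary_sum : 'X_l * dunkl k0 l h = - k0 *: h.
Proof.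
have nl : (n <= l)%N by rewrite /=; lia.
have -> : dunkl k0 l h = msym (tperm c l) (dunkl k0 c f).
  rewrite msym_dunkl tpermL /h dunklD dunkl_zero_part // add0r dunkl_sum.
  rewrite (bigD1 l) //= big1 ?addr0 // => j /andP[nj jl].
  have lE : l = tperm c j l by rewrite tpermD // -val_eqE /=; lia.
  by rewrite {1}lE -msym_dunkl dunkl_zero_part ?msym0.
by rewrite -{1}[l](tpermL c) -msymXi -msymM mulX_dunkl_boundary msymZ
  msym_boundary_sum.
Qed.

Lemma boundary_sum_eq0 : h = 0.
Proof.
apply/eqP; apply: contraT => nz_h.
have nl : (n <= l)%N by rewrite /=; lia.
have cl : c != l by rewrite -val_eqE /=; lia.
have hcl := msym_boundary_sum nl.
have [b /andP[b_h /allP b_max] b_xi] := exists_top_monomial k0 nz_h.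
have xi_l : 1 - k0 = xi k0 b l.
  apply: b_xi; rewrite dunklUE dunkl_boundary_sum big_pred0 ?scaler0 ?addr0.
    by rewrite scalerDl scale1r addrC scaleNr.
  by move=> k /=; have := ltn_ord k; lia.
have xi_c : 1 - k0 + mu%:R * k0 = xi k0 b c.
  apply: b_xi; rewrite dunklUE.
  have -> : 'X_c * dunkl k0 c h = - k0 *: h.
    rewrite -{1 2}[c](tpermR c l) -hcl -msym_dunkl -msymXi -msymM.
    by rewrite dunkl_boundary_sum msymZ hcl.
  rewrite (eq_bigr (fun=> h)); last by move=> k /= ck;
    apply: msym_boundary_sum; lia.
  rewrite (eq_bigl (fun j : 'I_N => xpredT j && (n <= j)%N));
    last by move=> j /=; lia.
  rewrite -(big_geq_mkord n N xpredT (fun=> h)) sumr_const_nat -scaler_nat.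
  have -> : (N - n = mu)%N by lia.
  by rewrite scalerA !scalerDl scaleNr scale1r [- _ + _]addrC mulrC.
(* Here (mu + 1) b_l = m (N + 1 - r_l), and a rank is at most N. *)
have bl : (0 < b l)%N.
  have : (mu.+1 * b l + m * comp_rank b l = mu.+1 * 0 + m * N.+1)%N.
    by apply: xi_eq_nat; rewrite -k0E -xi_l -natr1; ring.
  by have := comp_rank_leN b l; nia.
have bc : b c = 0%N.
  have Mbc : (mu.+1 * b c + m * comp_rank b c = mu.+1 * 0 + m * n.+1)%N.
    apply: xi_eq_nat; rewrite -k0E -xi_c -natr1.
    by rewrite natrB ?(ltnW lt_muN) //; ring.
  have le_r : (comp_rank b c <= n.+1)%N by nia.
  have r_gt0 := comp_rank_gt0 b c.
  have Mb : (mu.+1 * b c = m * (n.+1 - comp_rank b c))%N by nia.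
  have: (n.+1 - comp_rank b c = 0)%N.
    by apply: (dvdn_gcd_small gcd_lt); [lia|rewrite -Mb dvdn_mulr].
  by move=> r0; move: Mb; rewrite r0 muln0; lia.
(* By symmetry of h the exchanged exponent occurs as well, and it is strictly above the maximal
   b. *)
have bl_h : mnm_upd2 b c l (b l) (b c) \in msupp h.
  by rewrite -mnm_upd2_tperm mcoeff_msupp -mcoeff_sym hcl -mcoeff_msupp.
have := b_max _ bl_h; apply: contraLR => _; set b' := mnm_upd2 _ _ _ _ _.
have b'c : b' c = b l by rewrite mnmE eqxx.
have b'l : b' l = b c by rewrite mnmE eqxx eq_sym (negPf cl).
have -> : b = mnm_upd2 b' c l (b' l) (b' c).
  rewrite b'c b'l; apply/mnmP => k; rewrite !mnmE.
  by case: eqP => [->|_] //; case: eqP => [->|].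
by apply: mnm_upd2_wt; rewrite ?b'c ?b'l ?bc //=; lia.
Qed.

Lemma rect_singular (i : 'I_N) : dunkl k0 i f = 0.
Proof.
have [i_n|/dunkl_zero_part //] := ltnP i n.
have Dc : dunkl k0 c f = 0.
  have /eqP := mulX_dunkl_boundary; rewrite boundary_sum_eq0 scaler0 mulf_eq0.
  by case/orP => [|/eqP //]; rewrite (negPf (mpolyX_neq0 _ _)).
have := msym_dunkl k0 (tperm c i) c f;
  rewrite Dc msym0 tpermL msym_young_tperm /=; first exact: esym.
by rewrite i_n; lia.
Qed.

(** For i = c this is [boundary_sum_eq0]; applying (i, c), which fixes f, moves c to i. *)
Lemma rect_relation (i : 'I_N) : (i < n)%N ->
  f + \sum_(j < N | (n <= j)%N) msym (tperm i j) f = 0.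
Proof.
move=> i_n; have := congr1 (msym (tperm i c)) boundary_sum_eq0.
rewrite msym0 /h msymD raddf_sum /= msym_young_tperm => [eq0|];
  last by rewrite i_n /=; lia.
rewrite -[RHS]eq0; congr (_ + _); apply: eq_bigr => j n_j; rewrite -msymMm.
have [-> | ic] := eqVneq i c; first by rewrite tperm1 mulg1.
have -> : (tperm c j * tperm i c = tperm i c * tperm i j)%g.
  rewrite [LHS]conjgC tpermJ tpermR [tperm i c j]tpermD // -val_eqE /=.
    by apply/eqP => ij; move: n_j; rewrite -ij; lia.
  by lia.
by rewrite msymMm (@msym_young_tperm i c) // i_n /=; lia.
Qed.

End Singular.

(** * Spherical functions of the Young subgroup *)

Import Order.TTheory Num.Theory.

Section YoungGroup.

Context (N n : nat).
Implicit Types (u v w : 'S_N) (i j : 'I_N).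
Local Notation stab := (young_stab N n).

Lemma young_stab1 : 1%g \in stab.
Proof. by apply/young_stabP => i; rewrite perm1. Qed.

Lemma young_stabM u w : u \in stab -> ((u * w)%g \in stab) = (w \in stab).
Proof.
move/young_stabP => u_st; apply/young_stabP/young_stabP => w_st i.
  by have := w_st ((u^-1)%g i); rewrite permM permKV => ->; rewrite -u_st permKV.
by rewrite permM w_st u_st.
Qed.

Lemma young_stabV u : (u^-1%g \in stab) = (u \in stab).
Proof.
have sub w : w \in stab -> w^-1%g \in stab.
  by move=> w_st; rewrite -(young_stabM _ w_st) mulgV young_stab1.
by apply/idP/idP => [/sub|/sub //]; rewrite invgK.
Qed.

Lemma young_stab_tperm i j : (i < n)%N = (j < n)%N -> tperm i j \in stab.
Proof. by move=> eq_n; apply/young_stabP => k; case: tpermP => // ->. Qed.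

Definition crossings w := #|[pred i : 'I_N | (i < n)%N && (n <= w i)%N]|.

Lemma crossings0_stab w : crossings w = 0%N -> w \in stab.
Proof.
move=> /card0_eq w0; have wA i : (i < n)%N -> (w i < n)%N.
  by move=> i_n; have := w0 i; rewrite !inE i_n /= ltnNge => ->.
have wAE : w @: [set i : 'I_N | (i < n)%N] = [set i : 'I_N | (i < n)%N].
  apply/eqP; rewrite eqEcard card_imset ?leqnn ?andbT; last exact: perm_inj.
  by apply/subsetP => _ /imsetP[i i_n ->]; move: i_n; rewrite !inE; exact: wA.
apply/young_stabP => i;
  have := mem_imset [set i : 'I_N | (i < n)%N] i (@perm_inj _ w).
by rewrite wAE !inE.
Qed.

Lemma crossings_tperm w i j :
  (i < n)%N -> (n <= j)%N -> (n <= w i)%N -> (w j < n)%N ->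
  (crossings (tperm i j * w)%g < crossings w)%N.
Proof.
move=> i_n n_j n_wi wj_n; apply: proper_card; apply/properP; split; last first.
  by exists i; rewrite !inE ?i_n // permM tpermL leqNgt wj_n andbF.
apply/subsetP => k; rewrite !inE permM => /andP[k_n]; rewrite k_n /=.
by case: tpermP => [->|kj|//]; rewrite ?n_wi //; move: k_n; rewrite kj ltnNge n_j.
Qed.

(* Both [w |-> coefficient of e w f] and [w |-> <w f, f>] are of this kind, and
   so are the coefficients of symmetrized elements of the Specht module. *)
Definition spherical (F : 'S_N -> rat) : Prop :=
  [/\ forall u w, u \in stab -> F (u * w)%g = F w,
      forall u w, u \in stab -> F (w * u)%g = F w
    & forall w i, (i < n)%N ->
        F w + \sum_(j < N | (n <= j)%N) F (tperm i j * w)%g = 0].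

(** If w moves i in A out of A, the terms of the relation with w j outside A equal F w, since (i, j)
    w = w (w i, w j) and F is invariant; the other terms have fewer crossings. Solving for F w gives
    a recursion for c that does not involve F. *)
Lemma spherical_line : exists c : 'S_N -> rat,
  forall F, spherical F -> forall w, F w = c w * F 1%g.
Proof.
suff /(_ N)[c cP] : forall d, exists c : 'S_N -> rat, forall F, spherical F ->
    forall w, (crossings w <= d)%N -> F w = c w * F 1%g.
  exists c => F F_sph w; apply: cP => //.
  by rewrite -[leqRHS]card_ord; exact: max_card.
elim=> [|d [c IHd]].
  exists (fun=> 1) => F [_ Fr _] w; rewrite leqn0 => /eqP/crossings0_stab w_st.
  by rewrite mul1r -(Fr w 1%g w_st) mul1g.
pose K w := [pred j : 'I_N | (n <= j)%N && (n <= w j)%N].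
pose c' w := if [pick i : 'I_N | (i < n)%N && (n <= w i)%N] is Some i
  then - (\sum_(j < N | (n <= j)%N && ~~ (n <= w j)%N) c (tperm i j * w)%g)
         / (#|K w|.+1)%:R
  else 1.
exists c' => F F_sph w; have [Fl Fr F_rel] := F_sph.
rewrite /c'; case: pickP => [i /andP[i_n n_wi]|w0] le_w; last first.
  by rewrite mul1r -(Fr w 1%g) ?mul1g // crossings0_stab //;
    apply: eq_card0 => i; exact: w0.
have k1_neq0 : (#|K w|.+1)%:R != 0 :> rat by rewrite pnatr_eq0.
apply: (mulIf k1_neq0); rewrite mulrAC mulfVK // mulNr mulr_suml.
have S1 : \sum_(j < N | (n <= j)%N && (n <= w j)%N) F
  (tperm i j * w)%g = F w *+ #|K w|.
  rewrite -sumr_const; apply: eq_big => // j /andP[n_j n_wj].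
  by rewrite conjgC tpermJ Fr // young_stab_tperm // !ltnNge n_wi n_wj.
have S2 : \sum_(j < N | (n <= j)%N && ~~ (n <= w j)%N) F (tperm i j * w)%g =
    \sum_(j < N | (n <= j)%N && ~~ (n <= w j)%N) c (tperm i j * w)%g * F 1%g.
  apply: eq_bigr => j /andP[n_j]; rewrite -ltnNge => wj_n; apply: (IHd F F_sph).
  by have := crossings_tperm i_n n_j n_wi wj_n; lia.
have := F_rel w i i_n; rewrite (bigID (fun j => n <= w j)%N) /= S1 S2.
rewrite addrA => /eqP; rewrite addr_eq0 => /eqP <-.
by rewrite -natr1 mulrDr mulr1 mulr_natr addrC.
Qed.

End YoungGroup.

(** * A permutation-invariant inner product *)

Section InnerProduct.

Context (N d : nat).
Implicit Types (p q : {mpoly rat[N]}) (w : 'S_N).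

(* The cut-off [d] keeps the sum over a fixed finite type. *)
Definition mdot p q : rat := \sum_(b : 'X_{1..N < d}) p@_b * q@_b.

Lemma mdotC p q : mdot p q = mdot q p.
Proof. by apply: eq_bigr => b _; rewrite mulrC. Qed.

Lemma mdot_is_linear p : linear_for *%R (mdot p).
Proof.
move=> c q r; rewrite /mdot mulr_sumr -big_split; apply: eq_bigr => b _ /=.
by rewrite mcoeffD mcoeffZ; ring.
Qed.

HB.instance Definition _ p :=
  GRing.isLinear.Build rat {mpoly rat[N]} rat *%R (mdot p) (mdot_is_linear p).

Lemma mdotZ c p q : mdot p (c *: q) = c * mdot p q.
Proof. by rewrite /mdot mulr_sumr; apply: eq_bigr => b _;
  rewrite mcoeffZ mulrCA. Qed.

Lemma mdot_sym w p q : mdot (msym w p) (msym w q) = mdot p q.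
Proof.
have lt_d (b : 'X_{1..N < d}) (u : 'S_N) : (mdeg [multinom (b :
  'X_{1..N}) (u i) | i < N] < d)%N.
  by rewrite mdeg_mperm bmdeg.
pose act u b := BMultinom (lt_d b u).
rewrite /mdot [RHS](reindex (act w)); last first.
  by exists (act (w^-1)%g) => b _; apply/val_inj/mnmP => i;
    rewrite !mnmE ?permK ?permKV.
by apply: eq_bigr => b _; rewrite !mcoeff_sym.
Qed.

Lemma mdot_symr w p q : mdot p (msym w q) = mdot (msym (w^-1)%g p) q.
Proof. by rewrite -[RHS](mdot_sym w) -msymMm mulVg msym1m. Qed.

Lemma mdot_gt0 p : p != 0 -> (msize p <= d)%N -> 0 < mdot p p.
Proof.
move=> nz_p le_pd; rewrite lt0r sumr_ge0 ?andbT => [|b _]; last exact: sqr_ge0.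
apply: contraNneq nz_p => /eqP; rewrite psumr_eq0 => [/allP p0|b _];
  last exact: sqr_ge0.
apply/eqP/mpolyP => b; rewrite mcoeff0; have [lt_b|le_b] := ltnP (mdeg b) d.
  by have := p0 (BMultinom lt_b) (mem_index_enum _);
    rewrite mulf_eq0 orbb => /eqP.
by apply/memN_msupp_eq0/msize_mdeg_ge/(leq_trans le_pd).
Qed.

End InnerProduct.

(** * Irreducibility of the span of an orbit *)

Section OrbitSpan.

Context (N n : nat) (f : {mpoly rat[N]}).
Implicit Types (p q : {mpoly rat[N]}) (u v w : 'S_N) (i j : 'I_N).
Local Notation stab := (young_stab N n).

Definition young_sum p := \sum_(v in stab) msym v p.

Lemma young_sum_is_linear : linear young_sum.
Proof.
move=> c p q; rewrite /young_sum scaler_sumr -big_split; apply: eq_bigr => v _ /=.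
by rewrite msymD msymZ.
Qed.

HB.instance Definition _ :=
  GRing.isLinear.Build rat {mpoly rat[N]} {mpoly rat[N]} *:%R young_sum
    young_sum_is_linear.

Lemma young_sum_msym u p : u \in stab -> young_sum (msym u p) = young_sum p.
Proof.
move=> u_st; rewrite /young_sum [RHS](reindex_inj (mulgI u)).
by apply: eq_big => [v|v _]; rewrite ?young_stabM ?msymMm.
Qed.

Lemma msym_young_sum u p : u \in stab -> msym u (young_sum p) = young_sum p.
Proof.
move=> u_st; rewrite /young_sum raddf_sum [RHS](reindex_inj (mulIg u)).
apply: eq_big => [v|v _]; last by rewrite /= -msymMm.
apply/idP/idP => [v_st|vu_st]; first by rewrite young_stabM.
by rewrite -(mulgK u v) young_stabM ?young_stabV.
Qed.

Definition orbit_span p := exists a : 'S_N -> rat, p = \sum_w a w *: msym w f.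

Lemma orbit_span_submodule : submodule orbit_span.
Proof.
split.
- by exists (fun=> 0); rewrite big1 // => w _; rewrite scale0r.
- move=> c p q [a ->] [a' ->]; exists (fun w => c * a w + a' w).
  rewrite scaler_sumr -big_split; apply: eq_bigr => w _ /=.
  by rewrite scalerDl scalerA.
- move=> u p [a ->]; exists (fun w => a (w * u^-1)%g).
  rewrite raddf_sum [RHS](reindex_inj (mulIg u)); apply: eq_bigr => w _ /=.
  by rewrite msymZ -msymMm mulgK.
Qed.

Lemma orbit_span_id : orbit_span f.
Proof.
exists (fun w => (w == 1%g)%:R); rewrite (bigD1 1%g) //= eqxx scale1r msym1m.
by rewrite big1 ?addr0 // => w /negPf ->; rewrite scale0r.
Qed.

Lemma submodule_sum (W : {mpoly rat[N]} ->
  Prop) I (r : seq I) (P : pred I) (F : I -> {mpoly rat[N]}) :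
  submodule W -> (forall k, P k -> W (F k)) -> W (\sum_(k <- r | P k) F k).
Proof.
move=> [W0 WD _] WF; apply: (big_ind W) => // p q Wp Wq.
by rewrite -[p]scale1r; apply: WD.
Qed.

Lemma submoduleZ (W : {mpoly rat[N]} -> Prop) c p : submodule W -> W p ->
  W (c *: p).
Proof. by move=> [W0 WD _] Wp; rewrite -[_ *: _]addr0; apply: WD. Qed.

Lemma orbit_span_min (W : {mpoly rat[N]} -> Prop) :
  submodule W -> W f -> forall p, orbit_span p -> W p.
Proof.
move=> subW Wf p [a ->]; apply: submodule_sum => // w _; apply: submoduleZ => //.
by case: subW => _ _; apply.
Qed.

Hypothesis f_stab : forall u, u \in stab -> msym u f = f.
Hypothesis f_rel : forall i, (i < n)%N ->
  f + \sum_(j < N | (n <= j)%N) msym (tperm i j) f = 0.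

Lemma young_sum_id : young_sum f = #|stab|%:R *: f.
Proof. by rewrite /young_sum (eq_bigr (fun=> f)) // sumr_const scaler_nat. Qed.

Lemma msym_rel w i : (i < n)%N ->
  msym w f + \sum_(j < N | (n <= j)%N) msym (tperm i j * w)%g f = 0.
Proof.
move=> i_n; have := congr1 (msym w) (f_rel i_n).
rewrite msymD msym0 raddf_sum => eq0; rewrite -[RHS]eq0; congr (_ + _).
by apply: eq_bigr => j _; rewrite msymMm.
Qed.

(** For each b, the coefficient of x^b in [young_sum (msym w f)] is a spherical function of w. The
    factor from [spherical_line] is the same for all b, so the whole polynomial is a multiple of
    f. *)
Lemma young_sum_orbit_span p : orbit_span p -> exists c, young_sum p = c *: f.
Proof.
have [c cP] := spherical_line N n => -[a ->].
suff eW w : young_sum (msym w f) = (c w * #|stab|%:R) *: f.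
  exists (\sum_w a w * (c w * #|stab|%:R)); rewrite scaler_suml raddf_sum.
  by apply: eq_bigr => w _; rewrite /= linearZ /= eW scalerA.
apply/mpolyP => b; rewrite -scalerA mcoeffZ -young_sum_id.
apply: etrans (cP (fun w => (young_sum (msym w f))@_b) _ w) _;
  last by rewrite msym1m.
split=> [u v u_st|u v u_st|v i i_n].
- by rewrite msymMm f_stab.
- by rewrite msymMm young_sum_msym.
- have sumE := raddf_sum young_sum (index_enum 'I_N) (fun j => n <= j)%N
  (fun j => msym (tperm i j * v)%g f).
  have := congr1 young_sum (msym_rel v i_n);
    rewrite (raddfD young_sum) (raddf0 young_sum).
  move=> /(etrans (congr1 (+%R _) (esym sumE))) /(congr1 (mcoeff b)).
  rewrite mcoeffD mcoeff0 => eq0; rewrite -[RHS]eq0; congr (_ + _).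
  exact/esym/(raddf_sum (mcoeff b)).
Qed.

Hypothesis f_neq0 : f != 0.

(** Permuting variables keeps degrees, so the cut-off [msize f] makes [mdot] positive definite on
    the span. *)
Lemma orbit_span_msize p : orbit_span p -> (msize p <= msize f)%N.
Proof.
move=> [a ->]; apply: leq_trans (msize_sum _ _ _) _;
  apply/bigmax_leqP_seq => w _ _.
apply: leq_trans (msizeZ_le _ _) _; rewrite msizeE;
  apply/bigmax_leqP_seq => b b_w _.
have := msize_mdeg_lt (p := f) (m := [multinom b (w i) | i < N]).
by rewrite mdeg_mperm; apply; rewrite mcoeff_msupp -mcoeff_sym -mcoeff_msupp.
Qed.

(** If a submodule W contains p != 0 but not f, each [young_sum (msym w p)] lies in W and on the
    line of f, hence is 0. So p is orthogonal to every w f, and thus to itself. *)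
Lemma orbit_span_irreducible : irreducible_submodule orbit_span.
Proof.
split; [exact: orbit_span_submodule|by exists f => //; exact: orbit_span_id|].
move=> W subW W_V.
case: (classic (forall p, W p -> p = 0)) => [W0|nW0]; first by left.
have [p np] := not_all_ex_not _ _ nW0; have [Wp nz_p] := imply_to_and _ _ np.
right; apply: orbit_span_min => //; apply: NNPP => nWf; apply: nz_p.
have e0 w : young_sum (msym w p) = 0.
  have Wwp : W (msym w p) by case: subW => _ _; apply.
  have [c ec] := young_sum_orbit_span (W_V _ Wwp).
  have [c0|c0] := eqVneq c 0; first by rewrite ec c0 scale0r.
  case: nWf; rewrite -[f]scale1r -(mulVf c0) -scalerA -ec;
    apply: submoduleZ => //.
  by apply: submodule_sum => // v _; case: subW => _ _; apply.
set d := msize f.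
have pf0 w : mdot d p (msym w f) = 0.
  (* The form is invariant and f is fixed by the Young subgroup, so symmetrizing the other argument
     only multiplies the product by the group order. *)
  have : mdot d (young_sum (msym w^-1 p)) f = #|stab|%:R * mdot d p (msym w f).
    rewrite mdotC raddf_sum mulr_natl -sumr_const /=; apply: eq_bigr => v v_st.
    by rewrite mdot_symr f_stab ?young_stabV // mdotC mdot_symr.
  rewrite e0 mdotC raddf0 => /esym/eqP;
    rewrite mulf_eq0 pnatr_eq0 => /orP[|/eqP//].
  by move/eqP/card0_eq/(_ 1%g); rewrite [_ \in _]young_stab1.
apply/eqP; apply: contraT => nz; have /W_V Vp := Wp.
have := mdot_gt0 nz (orbit_span_msize Vp); have [a pE] := Vp.
rewrite {2}pE raddf_sum big1 ?ltxx // => w _.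
by rewrite /= mdotZ pf0 mulr0.
Qed.

End OrbitSpan.

(** * Two-row Specht modules *)

Section Tableaux.

Context (N : nat).
Implicit Types (T : {ffun 'I_N -> 'I_N * 'I_N}) (w : 'S_N) (i j : 'I_N).

Lemma msym_specht w T :
  msym w (specht_poly T) = specht_poly [ffun i => T ((w^-1)%g i)].
Proof.
rewrite /specht_poly rmorph_prod [RHS](reindex_inj (@perm_inj _ w)).
apply: eq_bigr => i _; rewrite rmorph_prod [RHS](reindex_inj (@perm_inj _ w)).
by apply: eq_big => [j|j _]; rewrite ?ffunE ?permK //= msymB !msymXi.
Qed.

Lemma tableau_perm tau w T :
  is_tableau tau [ffun i => T (w i)] = is_tableau tau T.
Proof.
have sub (u : 'S_N) T' : is_tableau tau T' -> is_tableau tau [ffun i => T' (u i)].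
  case/andP=> /injectiveP T_inj /forallP T_in; apply/andP; split; last first.
    by apply/forallP => i; rewrite ffunE.
  by apply/injectiveP => i j; rewrite !ffunE => /T_inj/perm_inj.
apply/idP/idP => [/(sub w^-1%g)|/sub //]; congr (is_tableau _ _).
by apply/ffunP => i; rewrite !ffunE permKV.
Qed.

Lemma specht_submodule tau : submodule (specht_module (N := N) tau).
Proof.
split.
- by exists (fun=> 0); rewrite big1 // => T _; rewrite scale0r.
- move=> c p q [a ->] [a' ->]; exists (fun T => c * a T + a' T).
  rewrite scaler_sumr -big_split; apply: eq_bigr => T _ /=.
  by rewrite scalerDl scalerA.
- move=> w p [a ->]; exists (fun T => a [ffun i => T (w i)]).
  rewrite raddf_sum [RHS](reindex (fun T => [ffun i => T ((w^-1)%g i)])) /=;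
    last first.
    exists (fun T => [ffun i => T (w i)]) => T _; apply/ffunP => i;
      by rewrite !ffunE ?permK ?permKV.
  apply: eq_big => [T|T _]; first by rewrite tableau_perm.
  rewrite msymZ msym_specht; congr (a _ *: _).
  by apply/ffunP => i; rewrite !ffunE permK.
Qed.

Lemma specht_neq0 T : specht_poly T != 0.
Proof.
apply/prodf_neq0 => i _; apply/prodf_neq0 => j /andP[_ lt_ij].
by apply: subXX_neq0; apply: contraTneq lt_ij => ->; rewrite ltnn.
Qed.

Lemma specht_in tau T : is_tableau tau T -> specht_module tau (specht_poly T).
Proof.
move=> T_tab; exists (fun T' => (T' == T)%:R); rewrite (bigD1 T) //= eqxx scale1r.
by rewrite big1 ?addr0 // => T' /andP[_ /negPf ->]; rewrite scale0r.
Qed.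

Context (mu n : nat).
Hypotheses (n_mu : (n <= mu)%N) (N_mu : N = (mu + n)%N) (n_gt0 : (0 < n)%N).
Local Notation tau := [:: mu; n].

Lemma tableau_rows T i : is_tableau tau T ->
  ((T i).1 = 0%N :> nat /\ (T i).2 < mu \/ (T i).1 = 1%N :> nat /\ (T i).2 < n)%N.
Proof.
case/andP=> _ /forallP/(_ i); case: (nat_of_ord (T i).1) => [|[|r]] /=;
  [by left|by right|].
by rewrite nth_nil.
Qed.

(** In two rows a column has at most two boxes, so x_i - x_j, up to sign, is the only factor
    containing either variable. *)
Lemma specht_column_swap T i j : is_tableau tau T -> i != j ->
  (T i).2 = (T j).2 ->
  msym (tperm i j) (specht_poly T) = - specht_poly T.
Proof.
move=> T_tab; have rows k := tableau_rows k T_tab.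
have T_inj : injective T by case/andP: T_tab => /injectiveP.
have row_inj k k' : (T k).2 = (T k').2 -> (T k).1 = (T k').1 :> nat -> k = k'.
  move=> eq2 eq1; apply: T_inj; move: eq1 eq2;
    case: (T k) (T k') => [r c] [r' c'] /=.
  by move=> /val_inj -> ->.
wlog lt_ij : i j / ((T i).1 < (T j).1)%N.
  move=> wl ij col; case: (ltngtP (T i).1 (T j).1) => [lt|lt|eq1];
    first exact: wl.
    by rewrite tpermC; apply: wl; rewrite 1?eq_sym.
  by case/eqP: ij; apply: row_inj.
move=> ij col; rewrite /specht_poly pair_big_dep /= (bigD1 (i, j)) /=; last first.
  by rewrite col eqxx.
rewrite msymM msymB !msymXi tpermL tpermR -mulNr opprB; congr (_ * _).
rewrite rmorph_prod; apply: eq_bigr => -[k k'] /= /andP[/andP[/eqP kcol lt_k]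
  kk'].
have ri := rows i; have rj := rows j; have rk := rows k; have rk' := rows k'.
have ki : k != i.
  apply: contraNneq kk' => kE; rewrite xpair_eqE kE eqxx; apply/eqP/row_inj.
    by rewrite -kcol kE.
  by rewrite kE in lt_k; lia.
have kj : k != j by apply: contraTneq lt_k => kE; rewrite kE in rk *; lia.
have k'i : k' != i by apply: contraTneq lt_k => kE; rewrite kE; lia.
have k'j : k' != j.
  apply: contraNneq kk' => kE; rewrite xpair_eqE kE eqxx andbT; apply/eqP/row_inj.
    by rewrite kcol kE.
  by rewrite kE in lt_k; lia.
by rewrite msymB !msymXi !tpermD // eq_sym.
Qed.

End Tableaux.

Lemma perm_eq_01 (s t : seq nat) :
  all (leq^~ 1%N) s -> all (leq^~ 1%N) t -> size s = size t -> sumn s = sumn t ->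
  perm_eq s t.
Proof.
have cnt (a : pred nat) (r : seq nat) : all (leq^~ 1%N) r ->
    (count a r + a 0 * sumn r = a 0 * size r + a 1 * sumn r)%N.
  elim: r => [|x r IHr] /=; first by rewrite !muln0.
  case/andP=> x01 /IHr; case: x x01 => [|[|//]] _ /=;
    by case: (a 0%N); case: (a 1%N); lia.
move=> s01 t01 eq_size eq_sum; apply/seq.permP => a.
by have := cnt a s s01; rewrite eq_size eq_sum -(cnt a t t01) => /addIn.
Qed.

Lemma squarefree_orbit (N n : nat) (b : 'X_{1..N}) :
  (n <= N)%N -> (forall i, b i <= 1)%N -> mdeg b = n ->
  exists w : 'S_N, b = [multinom ((w i < n)%N : nat) | i < N].
Proof.
move=> nN b01 b_deg; pose a : 'X_{1..N} := [multinom ((i < n)%N : nat) | i < N].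
have a01 i : (a i <= 1)%N by rewrite mnmE leq_b1.
have all01 (c : 'X_{1..N}) : (forall i, c i <= 1)%N -> all (leq^~ 1%N) c.
  by move=> c01; apply/allP => _ /tnthP[i ->]; rewrite -mnm_tnth.
have : perm_eq b a.
  apply: perm_eq_01; rewrite ?all01 ?size_tuple // !sumnE.
  rewrite -![\sum_(i <- _) i]/(mdeg _) b_deg mdegE.
  by rewrite (eq_bigr (fun i : 'I_N => (i < n)%N :
    nat)) ?sum_ltn_ord // => i _; rewrite mnmE.
case/tuple_permP=> w bE; exists w; apply/mnmP => i.
rewrite mnmE mnm_tnth (tnth_nth 0%N) bE -tnth_nth tnth_mktuple -mnm_tnth mnmE.
by [].
Qed.

Lemma msupp_prod_XsubX (R : nzRingType) (N : nat) (up : 'I_N ->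
  'I_N) (r : seq 'I_N) b :
  b \in msupp (\prod_(j <- r) ('X_(up j) - 'X_j) : {mpoly R[N]}) ->
  mdeg b = size r /\
  forall x, (b x <= \sum_(j <- r) ((up j == x) + (j == x)))%N.
Proof.
elim: r b => [|j r IHr] b.
  rewrite big_nil msupp1 inE => /eqP ->; rewrite mdeg0; split=> // x.
  by rewrite big_nil mnm0E.
rewrite big_cons => /msuppM_le/allpairsP[[b1 b2] /= [b1_in /IHr[deg2 le2] ->]].
have [k kE ->] : exists2 k, k \in [:: up j; j] & b1 = U_(k)%MM.
  move/msuppB_le: b1_in; rewrite mem_cat !msuppX !inE => /orP[] /eqP ->.
    by exists (up j); rewrite ?inE ?eqxx.
  by exists j; rewrite ?inE ?eqxx ?orbT.
rewrite mdegD mdeg1 deg2; split=> // x; rewrite big_cons mnmDE mnm1E.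
apply: leq_add; last exact: le2.
by move: kE; rewrite !inE => /orP[] /eqP ->; rewrite ?leq_addr ?leq_addl.
Qed.

(** * Coefficients of two-row Specht polynomials *)

Section TwoRowSpecht.

Context (N mu n : nat).
Hypotheses (n_mu : (n <= mu)%N) (N_mu : N = (mu + n)%N) (n_gt0 : (0 < n)%N).
Implicit Types (T : {ffun 'I_N -> 'I_N * 'I_N}) (w : 'S_N) (i j : 'I_N).
Local Notation tau := [:: mu; n].
Local Notation one_A := [multinom ((k < n)%N : nat) | k < N].

Lemma card_geq_set : #|[set k : 'I_N | (n <= k)%N]| = mu.
Proof.
rewrite -sum1dep_card -(big_geq_mkord n N xpredT (fun=> 1%N)) sum_nat_const_nat.
by lia.
Qed.

Lemma card_lt_set k : (k <= N)%N -> #|[set x : 'I_N | (x < k)%N]| = k.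
Proof.
move=> kN; rewrite -sum1dep_card big_mkcond -[RHS](sum_ltn_ord kN).
by apply: eq_bigr => j _; case: ifP.
Qed.

Lemma specht_rel r i : specht_module tau r -> (i < n)%N ->
  r@_one_A + \sum_(j < N | (n <= j)%N) (msym (tperm i j) r)@_one_A = 0.
Proof.
move=> [a ->] i_n.
pose K := i |: [set k : 'I_N | (n <= k)%N].
(* [ind k] is the exponent of the squarefree monomial on A with i replaced by k; the relation is a
   sum over k in K. *)
pose ind k : 'X_{1..N} :=
  [multinom ((x == k) || (x < n)%N && (x != i) : nat) | x < N].
have notK : i \notin [set k : 'I_N | (n <= k)%N] by rewrite inE -ltnNge.
transitivity (\sum_(k in K)
  (\sum_(T | is_tableau tau T) a T *: specht_poly T)@_(ind k)).
  rewrite big_setU1 //=; congr (_ + _).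
    congr (_@_ _); apply/mnmP => x; rewrite !mnmE.
    by case: (eqVneq x i) => [->|_]; rewrite ?i_n ?andbT.
  apply: eq_big => [j|j n_j]; first by rewrite inE.
  rewrite mcoeff_sym; congr (_@_ _); apply/mnmP => x; rewrite !mnmE;
    congr (nat_of_bool _).
  case: tpermP => [->|->|/eqP xi /eqP xj].
  - by rewrite eqxx andbF orbF ltnNge n_j; apply/esym/negbTE/eqP => ij;
    move: n_j; rewrite -ij leqNgt i_n.
  - by rewrite i_n eqxx.
  - by rewrite (negPf xj) xi andbT.
under eq_bigr => k _ do rewrite raddf_sum.
rewrite exchange_big big1 //= => T T_tab.
(* K has mu + 1 elements and T has mu columns, so two elements of K lie in one column. *)
have [x xK [y yKx eq_col]] : exists2 x, x \in K & exists2 y,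
  y \in [predD1 K & x] & (T x).2 = (T y).2.
  apply/dinjectivePn/negP => /dinjectiveP col_inj.
  have := card_in_imset col_inj; rewrite cardsU1 notK card_geq_set => card_im.
  have : (#|[set (T k).2 | k in K]| <= #|[set z : 'I_N | (z < mu)%N]|)%N.
    apply/subset_leq_card/subsetP => _ /imsetP[k _ ->]; rewrite inE.
    by case: (tableau_rows k T_tab) => -[_]; lia.
  by rewrite card_im card_lt_set; lia.
move: yKx; rewrite inE /= => /andP[yx yK].
set t := tperm x y.
have tK k : (t k \in K) = (k \in K) by rewrite /t; case: tpermP => // ->;
  rewrite ?xK ?yK.
have anti : msym t (specht_poly T) = - specht_poly T.
  by apply: specht_column_swap T_tab _ eq_col; rewrite // eq_sym.
(* The transposition of x and y permutes the monomials [ind k] but changes the sign of the Specht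
   polynomial, so the sum is its own negative. *)
set S := \sum_(k in K) _.
suff SN : S = - S by apply/eqP;
  rewrite -[_ == 0](mulrn_eq0 S 2) mulr2n {1}SN addNr.
rewrite {1}/S (reindex_inj (@perm_inj _ t)) -sumrN; apply: eq_big => [k|k kK];
  first exact: tK.
rewrite /= !mcoeffZ -mulrN -mcoeffN -anti mcoeff_sym; congr (_ * _@_ _).
apply/mnmP => z; rewrite !mnmE; congr (nat_of_bool (_ || _)).
  by rewrite -(inj_eq (@perm_inj _ t)) /t tpermK.
have K0 k' : k' \in K -> (k' < n)%N && (k' != i) = false.
  by rewrite !inE ltnNge => /orP[/eqP->|->]; rewrite ?eqxx ?andbF.
by rewrite /t; case: tpermP => [->|->|//]; rewrite !K0.
Qed.

Lemma shift_subproof i : (i - n < N)%N.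
Proof. exact: leq_ltn_trans (leq_subr n i) (ltn_ord i). Qed.

Lemma row_subproof (r : bool) : (r < N)%N.
Proof. by rewrite N_mu; case: r; lia. Qed.

(* Second row 0, ..., n-1 and first row n, ..., N-1, so that the column of
   i < n consists of i and n + i. *)
Definition rect_tableau : {ffun 'I_N -> 'I_N * 'I_N} :=
  [ffun i : 'I_N => if (i < n)%N then (Ordinal (row_subproof true), i)
           else (Ordinal (row_subproof false), Ordinal (shift_subproof i))].

Lemma tableau_from_rect T : is_tableau tau T ->
  exists w, T = [ffun i => rect_tableau (w i)].
Proof.
move=> T_tab; have rows i := tableau_rows i T_tab.
(* [g i] is the index whose box in [rect_tableau] is the box of i in T. The default of [insubd] does
   not occur, as first-row columns are below mu. *)
pose g i : 'I_N := if (T i).1 == 0%N :> nat then insubd i (n +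
  (T i).2)%N else (T i).2.
have g0 i : (T i).1 = 0%N :> nat -> g i = (n + (T i).2)%N :> nat.
  move=> Ti; rewrite /g Ti eqxx val_insubd; case: ifP => // /negP[].
  by case: (rows i) => -[]; rewrite Ti //; lia.
have g1 i : (T i).1 = 1%N :> nat -> g i = (T i).2 by move=> Ti; rewrite /g Ti.
have T_inj : injective T by case/andP: T_tab => /injectiveP.
have pair_inj i j : (T i).1 = (T j).1 :> nat -> (T i).2 = (T j).2 :> nat -> i = j.
  move=> eq1 eq2; apply: T_inj; move: eq1 eq2;
    case: (T i) (T j) => [r c] [r' c'] /=.
  by move=> /val_inj -> /val_inj ->.
have g_inj : injective g.
  move=> i j /(congr1 val) /= eq_g.
  case: (rows i) (rows j) => -[ri ci] [] [rj cj]; apply: pair_inj;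
    rewrite ?ri ?rj //;
    move: eq_g; rewrite ?(g0 i ri) ?(g0 j rj) ?(g1 i ri) ?(g1 j rj); lia.
exists (perm g_inj); apply/ffunP => i; rewrite !ffunE permE.
case: (rows i) => -[ri ci].
  have -> : (g i < n)%N = false by rewrite (g0 i ri) ltnNge leq_addr.
  apply/eqP.
  by rewrite [T i]surjective_pairing xpair_eqE -!val_eqE /= ri
    (g0 i ri) addKn !eqxx.
have -> : (g i < n)%N = true by rewrite (g1 i ri).
by apply/eqP; rewrite [T i]surjective_pairing xpair_eqE -!val_eqE /= ri
  (g1 i ri) !eqxx.
Qed.

Definition column_top (i : 'I_N) : 'I_N := insubd i (n + i)%N.

Lemma column_topE i : (i < n)%N -> column_top i = (n + i)%N :> nat.
Proof. by move=> i_n; rewrite val_insubd; case: ifP => // /negP[]; lia. Qed.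

Lemma specht_rectE :
  specht_poly rect_tableau = \prod_(j <- [seq j :
    'I_N <- enum 'I_N | (j < n)%N]) ('X_(column_top j) - 'X_j).
Proof.
rewrite big_filter big_enum_cond /= /specht_poly (exchange_big_dep xpredT) //=.
rewrite [RHS]big_mkcond /=; apply: eq_bigr => j _; case: ltnP => [j_n|n_j].
  rewrite (big_pred1 (column_top j)) // => i; rewrite /= !ffunE j_n -!val_eqE /=.
  rewrite (column_topE j_n); case: (ltnP i n) => [i_n|n_i] /=; lia.
rewrite big_pred0 // => i; rewrite !ffunE [(j < n)%N]ltnNge n_j /=.
by case: (ltnP i n); rewrite andbF.
Qed.

(** Distinct columns involve disjoint variables, so each variable occurs in at most one of the n
    factors. *)
Lemma specht_rect_support b : b \in msupp (specht_poly rect_tableau) ->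
  (forall i, b i <= 1)%N /\ mdeg b = n.
Proof.
rewrite specht_rectE => /msupp_prod_XsubX[-> le_b]; split; last first.
  rewrite size_filter -sum1_count big_enum_cond /= sum1dep_card card_lt_set //.
  by rewrite N_mu leq_addl.
move=> x; apply: leq_trans (le_b x) _; rewrite big_filter big_enum_cond /=.
have [x_n|n_x] := ltnP x n.
  rewrite (bigD1 x) //= eqxx big1 => [|j /andP[j_n jx]].
    by rewrite addn0 -val_eqE /= column_topE //; lia.
  by rewrite (negPf jx) -val_eqE /= column_topE //; lia.
have [/existsP[j0 /andP[j0_n /eqP j0x]]|/existsPn none] :=
    boolP [exists j : 'I_N, (j < n)%N && (column_top j == x)].
  rewrite (bigD1 j0) //= big1 => [|j /andP[j_n jj0]].
    by rewrite addn0 j0x eqxx -val_eqE /=; lia.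
  rewrite -j0x -!val_eqE /= !column_topE //.
  by move: jj0; rewrite -val_eqE /=; lia.
rewrite big1 // => j j_n; have := none j; rewrite j_n /= => /negPf ->.
by rewrite -val_eqE /=; lia.
Qed.

Lemma specht_support T b : is_tableau tau T -> b \in msupp (specht_poly T) ->
  exists w : 'S_N, b = [multinom ((w i < n)%N : nat) | i < N].
Proof.
move=> /tableau_from_rect[w ->].
have -> : [ffun i => rect_tableau (w i)] = [ffun i => rect_tableau
  ((w^-1)^-1%g i)].
  by apply/ffunP => i; rewrite !ffunE invgK.
rewrite -msym_specht mcoeff_msupp mcoeff_sym -mcoeff_msupp =>
  /specht_rect_support[b01 b_deg].
apply: squarefree_orbit; first by rewrite N_mu leq_addl.
  by move=> i; have := b01 (w i); rewrite mnmE permK.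
by rewrite -b_deg mdeg_mperm.
Qed.

Lemma rect_tableauP : is_tableau tau rect_tableau.
Proof.
apply/andP; split; last first.
  apply/forallP => i; rewrite ffunE; case: ifP => //= i_n.
  by have := ltn_ord i; lia.
apply/injectiveP => i j; rewrite !ffunE.
case: ifP => [i_n|i_n]; case: ifP => [j_n|j_n] [] //.
by move=> eq_ij; apply: val_inj => /=; lia.
Qed.

End TwoRowSpecht.

(** * The homomorphism from the Specht module *)

Section SpechtIso.

Context (N mu n : nat) (f : {mpoly rat[N]}).
Hypotheses (n_mu : (n <= mu)%N) (N_mu : N = (mu + n)%N) (n_gt0 : (0 < n)%N).
Implicit Types (p q : {mpoly rat[N]}) (w : 'S_N) (i j : 'I_N).
Local Notation tau := [:: mu; n].
Local Notation one_A := [multinom ((k < n)%N : nat) | k < N].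
Local Notation stab := (young_stab N n).

Hypothesis f_stab : forall u, u \in stab -> msym u f = f.
Hypothesis f_rel : forall i, (i < n)%N ->
  f + \sum_(j < N | (n <= j)%N) msym (tperm i j) f = 0.
Hypothesis f_neq0 : f != 0.

Lemma mcoeff_one_A_stab u p : u \in stab -> (msym u p)@_one_A = p@_one_A.
Proof.
move=> /young_stabP u_st; rewrite mcoeff_sym; congr (_@_ _).
by apply/mnmP => k; rewrite !mnmE u_st.
Qed.

(** Every monomial of a Specht polynomial is squarefree of degree n, so a permutation of the
    variables turns it into the product over A. *)
Lemma specht_mcoeff_neq0 p : specht_module tau p -> p != 0 ->
  exists w, (msym w p)@_one_A != 0.
Proof.
move=> [a pE] nz_p; have /negP := nz_p; rewrite -msupp_eq0.
case p_supp : (msupp p) => [//|b s] _.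
have pb : p@_b != 0 by rewrite -mcoeff_msupp p_supp mem_head.
have [/existsP[T /andP[T_tab Tb]]|/existsPn noT] :=
    boolP [exists T, is_tableau tau T && ((specht_poly T)@_b != 0)].
  rewrite -mcoeff_msupp in Tb.
  have [w bE] := specht_support n_mu N_mu n_gt0 T_tab Tb; exists w.
  rewrite mcoeff_sym (_ : [multinom _ | _ < _] = b) //.
  by rewrite bE; apply/mnmP => k; rewrite !mnmE.
case/negP: pb; rewrite pE raddf_sum big1 // => T T_tab; rewrite /= mcoeffZ.
by have := noT T; rewrite T_tab negbK => /eqP ->; rewrite mulr0.
Qed.

Definition specht_hom p := \sum_w (msym w^-1 p)@_one_A *: msym w f.

Lemma specht_hom_is_linear : linear specht_hom.
Proof.
move=> c p q; rewrite /specht_hom scaler_sumr -big_split;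
  apply: eq_bigr => w _ /=.
by rewrite msymD msymZ mcoeffD mcoeffZ scalerDl scalerA.
Qed.

HB.instance Definition _ :=
  GRing.isLinear.Build rat {mpoly rat[N]} {mpoly rat[N]} *:%R specht_hom
    specht_hom_is_linear.

Lemma specht_hom_msym u p : specht_hom (msym u p) = msym u (specht_hom p).
Proof.
rewrite /specht_hom raddf_sum (reindex_inj (mulIg u)); apply: eq_bigr => w _ /=.
by rewrite msymZ -!msymMm invMg mulKVg.
Qed.

(** If p were nonzero, the symmetrization q of a suitable translate would have a nonzero coefficient
    at [one_A]. The coefficients F of q and the inner products G of f with w f are both spherical,
    hence multiples of the same c, so the inner product of f with [specht_hom q] is F(1) G(1) times
    the sum of all c(w)^2. This is nonzero although [specht_hom q] vanishes. *)
Lemma specht_hom_inj0 p : specht_module tau p -> specht_hom p = 0 -> p = 0.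
Proof.
move=> SMp phi0; apply/eqP; apply: contraT => nz_p.
have [w0 w0p] := specht_mcoeff_neq0 SMp nz_p.
have SM := specht_submodule N tau; have [_ _ SMw] := SM.
pose q := young_sum n (msym w0 p).
have SMq : specht_module tau q by apply: submodule_sum => // v _; exact/SMw/SMw.
have phiq : specht_hom q = 0.
  rewrite /q /young_sum (raddf_sum specht_hom) big1 // => v _.
  by rewrite /= !specht_hom_msym phi0 !msym0.
pose F w := (msym w^-1 q)@_one_A; pose G w := mdot (msize f) f (msym w f).
have q_st u : u \in stab -> msym u q = q by exact: msym_young_sum.
have Fsph : spherical n F.
  split=> [u w u_st|u w u_st|w i i_n]; rewrite /F.
  - by rewrite invMg msymMm mcoeff_one_A_stab ?young_stabV.
  - by rewrite invMg msymMm q_st ?young_stabV.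
  - rewrite -[RHS](specht_rel n_mu N_mu n_gt0 (SMw w^-1%g q SMq) i_n);
    congr (_ + _).
    by apply: eq_bigr => j _; rewrite invMg tpermV msymMm.
have Gsph : spherical n G.
  split=> [u w u_st|u w u_st|w i i_n]; rewrite /G.
  - by rewrite msymMm f_stab.
  - by rewrite msymMm mdot_symr f_stab ?young_stabV.
  - have := congr1 (mdot (msize f) f) (msym_rel f_rel w i_n);
    rewrite raddfD raddf0 => eq0.
    by rewrite -[RHS]eq0; congr (_ + _);
      exact/esym/(raddf_sum (mdot (msize f) f)).
have F1 : F 1%g != 0.
  rewrite /F invg1 msym1m /q /young_sum raddf_sum /=.
  rewrite (eq_bigr (fun=> (msym w0 p)@_one_A)) => [|v v_st];
    last exact: mcoeff_one_A_stab.
  rewrite sumr_const mulrn_eq0 (negPf w0p) orbF -lt0n; apply/card_gt0P.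
  by exists 1%g; exact: young_stab1.
have G1 : 0 < G 1%g by rewrite /G msym1m mdot_gt0.
have [c cP] := spherical_line N n.
have c1 : c 1%g = 1 by apply: (mulIf F1); rewrite -(cP F Fsph) mul1r.
have: mdot (msize f) f (specht_hom q) = F 1%g * G 1%g * \sum_w c w ^+ 2.
  rewrite (raddf_sum (mdot (msize f) f)) mulr_sumr; apply: eq_bigr => w _ /=.
  by rewrite mdotZ -/(F w) -/(G w) (cP F Fsph w) (cP G Gsph w); ring.
rewrite phiq raddf0 => /esym/eqP; rewrite !mulf_eq0 (negPf F1) (gt_eqF G1) /=.
rewrite (bigD1 1%g) //= c1 expr1n gt_eqF // ltr_wpDr //.
by apply: sumr_ge0 => w _; exact: sqr_ge0.
Qed.

(** The image of [specht_hom] is a submodule of an irreducible one, and it is nonzero because a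
    Specht polynomial is nonzero and [specht_hom] is injective; hence it is the whole span. *)
Lemma orbit_span_isotype_iso :
  submodule_iso (specht_module tau) (orbit_span f).
Proof.
exists specht_hom; have [SM0 SMD SMw] := specht_submodule N tau.
split=> [c p q _ _|w p _|p q SMp SMq|q]; first exact: linearP.
- exact: specht_hom_msym.
- move=> /eqP; rewrite -subr_eq0 -raddfB => /eqP phi0; apply/eqP;
  rewrite -subr_eq0.
  apply/eqP/specht_hom_inj0 => //; rewrite addrC -scaleN1r.
  exact: SMD.
pose W q := exists2 p, specht_module tau p & q = specht_hom p.
have [subV _ irrV] := orbit_span_irreducible f_stab f_rel f_neq0.
have W_V r : W r -> orbit_span f r.
  move=> [p _ ->]; apply: submodule_sum => // w _; apply: submoduleZ => //.
  by case: subV => _ _; apply; exact: orbit_span_id.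
split; last exact: W_V.
have subW : submodule W.
  split; first by exists 0; rewrite ?raddf0.
    move=> c _ _ [p SMp ->] [p' SMp' ->]; exists (c *: p + p'); first exact: SMD.
    by rewrite linearP.
  by move=> w _ [p SMp ->]; exists (msym w p);
    [exact: SMw|rewrite specht_hom_msym].
case: (irrV W subW W_V) => [W0|]; last by apply.
have tabP := rect_tableauP n_mu N_mu n_gt0.
have SMt := specht_in tabP.
have /W0 phi0 : W (specht_hom (specht_poly
  (rect_tableau n_mu N_mu n_gt0))) by exists (specht_poly
    (rect_tableau n_mu N_mu n_gt0)).
by have := specht_neq0 (rect_tableau n_mu N_mu n_gt0);
  rewrite (specht_hom_inj0 SMt phi0) eqxx.
Qed.

End SpechtIso.

(** * Isotype of the specialized Jack polynomial *)

Unset Implicit Arguments.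

Theorem proposition8 (N mu m : nat)
    (hN : (0 < N)%N) (hmu : (0 < mu)%N) (hm : (0 < m)%N)
    (hNmu : (N%:R / 2%:R <= mu%:R :> rat)) (hmuN : (mu < N)%N)
    (hgcd : ((gcdn m mu.+1)%:R < mu.+1%:R / (N - mu)%N%:R :> rat))
    (zeta : {mpoly Qkappa[N]})
    (hzeta : is_jack [multinom (if (i < N - mu)%N then m else 0%N) | i < N]
               zeta) :
  let k0 : rat := - (m%:R / mu.+1%:R) in
  exists f : {mpoly rat[N]},
    [/\ specializes k0 zeta f,
        singular k0 f
      & isotype [:: mu; (N - mu)%N] f].
Proof.
move=> k0; set n := (N - mu)%N.
have n_gt0 : (0 < n)%N by rewrite subn_gt0.
have N_mu : N = (mu + n)%N by rewrite subnKC // ltnW.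
have n_mu : (n <= mu)%N.
  by move: hNmu; rewrite ler_pdivrMr ?ltr0n // -natrM ler_nat; lia.
have gcd_lt : (n * gcdn m mu.+1 < mu.+1)%N.
  by move: hgcd; rewrite ltr_pdivlMr ?ltr0n // -natrM ltr_nat mulnC.
set lambda := [multinom _ | _ < _] in hzeta.
have xi_uniq b : (forall i, xi k0 b i = xi k0 lambda i) -> b = lambda.
  exact: rect_spectrum_unique.
have [f [f_spec f_lambda f_deg Uf f_adj]] := jack_specialization hzeta xi_uniq.
have f_young w : w \in young_stab N n -> msym w f = f.
  (* Ranks of a partition increase by one, so neighbours in one block of lambda satisfy the
     hypotheses of [f_adj]. *)
  apply: msym_young => i j ji eq_n; apply: f_adj => //;
    last by rewrite !comp_rank_rect // ji.
  by rewrite !mnmE -/n eq_n.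
have f_neq0 : f != 0.
  by apply: contra_eq_neq f_lambda => ->; rewrite mcoeff0 eq_sym oner_eq0.
have f_sing := rect_singular hmu hm n_mu hmuN gcd_lt (erefl k0) f_young Uf.
have f_rel := rect_relation hmu hm n_mu hmuN gcd_lt (erefl k0) f_young Uf.
exists f; split=> //; exists (mdeg lambda), (orbit_span f); split.
- move=> p [a ->]; apply: rpred_sum => w _; apply: rpredZ; apply/dhomogP => b.
  rewrite mcoeff_msupp mcoeff_sym -mcoeff_msupp => /f_deg <-.
  exact/esym/mdeg_mperm.
- exact: orbit_span_irreducible f_young f_rel f_neq0.
- exact: orbit_span_isotype_iso n_mu N_mu n_gt0 f_young f_rel f_neq0.
- exact: orbit_span_id.
Qed.
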